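(* Let $\alpha$ be a finite Blaschke product with $m$ distinct zeros $a_1,\ldots,a_m$ and let $\beta$ be a finite Blaschke product with $n$ distinct zeros $b_1,\ldots,b_n$. Assume that $\alpha$ and $\beta$ have precisely $l$ zeros in common, namely $a_i=b_i$ for $i\leq l$ ($l=0$ if there are no zeros in common). Let $A$ be any linear transformation from $K_{\alpha}$ into $K_{\beta}$ and let $\widetilde{M}_A=(t_{s,p})_{1\le s\le n,\,1\le p\le m}$ be the matrix representation of $A$ with respect to the bases $\{\widetilde{k}_{a_1}^{\alpha},\ldots,\widetilde{k}_{a_m}^{\alpha}\}$ of $K_\alpha$ and $\{\widetilde{k}_{b_1}^{\beta},\ldots,\widetilde{k}_{b_n}^{\beta}\}$ of $K_\beta$. (a) If $l=0$, then $A\in\mathscr{T}(\alpha,\beta)$ if and only if $$t_{s,p}=\frac{\beta'(b_s)(a_1-b_s)t_{s,1}+\beta'(b_1)(b_1-a_1)t_{1,1}+\beta'(b_1)(a_p-b_1)t_{1,p}}{\beta'(b_s)(a_p-b_s)}$$ for all $1\leq p\leq m$ and $1\leq s\leq n$. (b) If $l>0$, then $A\in\mathscr{T}(\alpha,\beta)$ if and only if $$t_{s,p}=\frac{\beta'(b_1)(a_1-b_s)t_{1,s}+\beta'(b_1)(a_p-b_1)t_{1,p}}{\beta'(b_s)(a_p-b_s)}$$ for all $p,s$ such that $1\leq p\leq m$, $1\leq s\leq l$, $s\neq p$, and $$t_{s,p}=\frac{\beta'(b_s)(a_1-b_s)t_{s,1}+\beta'(b_1)(a_p-b_1)t_{1,p}}{\beta'(b_s)(a_p-b_s)}$$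 for all $p,s$ such that $1\leq p\leq m$, $l<s\leq n$.
   Context: $H^2$ is the classical Hardy space of the unit disk $\mathbb{D}$, identified via boundary values with a closed subspace of $L^2(\partial\mathbb{D})$. Here $m,n\ge 1$ and the finite Blaschke products are $$\alpha(z)=\prod_{i=1}^{m}\frac{a_i-z}{1-\overline{a}_iz},\qquad \beta(z)=\prod_{j=1}^{n}\frac{b_j-z}{1-\overline{b}_jz},\qquad a_i,b_j\in\mathbb{D},$$ with the $a_i$ pairwise distinct and the $b_j$ pairwise distinct. ''Precisely $l$ zeros in common'' means $\{a_1,\ldots,a_m\}\cap\{b_1,\ldots,b_n\}$ has exactly $l$ elements, and the zeros are indexed so that these are $a_i=b_i$, $1\le i\leq l$. The model space of an inner function $\alpha$ is $K_{\alpha}=H^2\ominus\alpha H^2$; $P_{\alpha}$ is the orthogonal projection from $L^2(\partial\mathbb{D})$ onto $K_\alpha$. For $w\in\mathbb{D}$ the conjugate kernel is $\widetilde{k}_{w}^{\alpha}(z)=\frac{\alpha(z)-\alpha(w)}{z-w}$, which belongs to $K_\alpha$. For the finite Blaschke products $\alpha(z)=\prod_{i=1}^{m}\frac{a_i-z}{1-\overline{a}_iz}$ with pairwise distinct zeros $a_1,\ldots,a_m\in\mathbb{D}$ and $\beta(z)=\prod_{j=1}^{n}\frac{b_j-z}{1-\overline{b}_jz}$ with pairwise distinct zeros $b_1,\ldots,b_n\in\mathbb{D}$, $\{\widetilde{k}_{a_1}^{\alpha},\ldots,\widetilde{k}_{a_m}^{\alpha}\}$ is a basis of $K_\alpha$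 and $\{\widetilde{k}_{b_1}^{\beta},\ldots,\widetilde{k}_{b_n}^{\beta}\}$ is a basis of $K_\beta$; the matrix $\widetilde{M}_A=(t_{s,p})$ is defined by $A\widetilde{k}_{a_p}^{\alpha}=\sum_{s=1}^{n}t_{s,p}\widetilde{k}_{b_s}^{\beta}$, $p=1,\ldots,m$. For $\varphi\in L^2(\partial\mathbb{D})$ the asymmetric truncated Toeplitz operator $A_{\varphi}^{\alpha,\beta}\colon K_\alpha\to K_\beta$ is $A_{\varphi}^{\alpha,\beta}f=P_{\beta}(\varphi f)$ (functions in the finite-dimensional space $K_\alpha$ are bounded), and $\mathscr{T}(\alpha,\beta)=\{A_{\varphi}^{\alpha,\beta}\colon \varphi\in L^2(\partial\mathbb{D})\text{ and }A_{\varphi}^{\alpha,\beta}\text{ is bounded}\}$. *)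

(* Defs.v *)
From HB Require Import structures.
From mathcomp Require Import all_boot all_order all_algebra.
From mathcomp Require Import complex.
From mathcomp Require Import all_classical all_reals all_analysis.

Set Implicit Arguments.
Unset Strict Implicit.
Unset Printing Implicit Defensive.

Import Order.TTheory GRing.Theory Num.Theory.
Import numFieldNormedType.Exports.

Local Open Scope classical_set_scope.
Local Open Scope ring_scope.
Local Open Scope complex_scope.

(* A function on the unit circle is represented by a function R[i] -> R[i], of
   which only the values at the points expi t, 0 <= t <= 2 pi, matter.
   Elements of L^2 are not quotiented: equality in L^2 is [circle_eq]. *)

Section UnitCircle.
Context {R : realType}.
Implicit Types (f g h phi alpha beta : R[i] -> R[i]) (w z : R[i]).

Definition abs z : R := complex.Re `|z|.

Definition in_disk z : Prop := abs z < 1.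

Definition expi (t : R) : R[i] := cos t +i* sin t.

Definition angles : set R := `[0, 2 * pi].

Definition circle_eq f g : Prop :=
  ae_eq (@lebesgue_measure R) angles (f \o expi) (g \o expi).

Definition L2 f : Prop :=
  [/\ measurable_fun angles (fun t => complex.Re (f (expi t))),
      measurable_fun angles (fun t => complex.Im (f (expi t))) &
      (@lebesgue_measure R).-integrable angles
        (fun t => (abs (f (expi t)) ^+ 2)%:E)].

(* Integral against normalized arc length. *)
Definition circle_int f : R[i] :=
  ((2 * pi)^-1 *
     \int[@lebesgue_measure R]_(t in angles) complex.Re (f (expi t)))
  +i*
  ((2 * pi)^-1 *
     \int[@lebesgue_measure R]_(t in angles) complex.Im (f (expi t))).

Definition inner f g : R[i] := circle_int (fun z => f z * (g z)^*).

Definition L2norm f : R := Num.sqrt (complex.Re (inner f f)).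

(* f is the radial boundary function of a holomorphic function F on the disk
   whose Taylor coefficients c are square-summable.  The alias R[i]^o carries
   the usual topology of the complex numbers. *)
Definition H2 f : Prop :=
  L2 f /\
  exists (c : nat -> R[i]) (F : R[i] -> R[i]),
    [/\ cvgn (series (fun k => abs (c k) ^+ 2)),
        forall z, in_disk z ->
          (series (fun k => c k * z ^+ k) : nat -> R[i]^o) @ \oo
            --> (F z : R[i]^o) &
        {ae @lebesgue_measure R, forall t, angles t ->
          (F (r%:C * expi t) : R[i]^o) @[r --> (1 : R)^'-]
            --> (f (expi t) : R[i]^o)}].

Definition model_space alpha f : Prop :=
  H2 f /\ forall h, H2 h -> inner f (fun z => alpha z * h z) = 0.

Definition conj_kernel alpha w z : R[i] := (alpha z - alpha w) / (z - w).

(* g is the orthogonal projection of f : L^2 onto the subspace K. *)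
Definition is_proj (K : (R[i] -> R[i]) -> Prop) f g : Prop :=
  [/\ L2 f, K g & forall h, K h -> inner (fun z => f z - g z) h = 0].

(* Linear maps from K to L, where K and L are subspaces of L^2; in particular
   they are well defined on classes modulo equality almost everywhere. *)
Definition linear_map (K L : (R[i] -> R[i]) -> Prop)
    (A : (R[i] -> R[i]) -> (R[i] -> R[i])) : Prop :=
  [/\ forall f, K f -> L (A f),
      forall f g, K f -> K g -> circle_eq f g -> circle_eq (A f) (A g) &
      forall (c : R[i]) f g, K f -> K g ->
        circle_eq (A (fun z => c * f z + g z)) (fun z => c * A f z + A g z)].

Definition bounded_map (K : (R[i] -> R[i]) -> Prop)
    (A : (R[i] -> R[i]) -> (R[i] -> R[i])) : Prop :=
  exists M : R, forall f, K f -> L2norm (A f) <= M * L2norm f.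

(* A is the operator A_phi^{alpha, beta} : f |-> P_beta (phi f). *)
Definition is_ATTO alpha beta phi
    (A : (R[i] -> R[i]) -> (R[i] -> R[i])) : Prop :=
  forall f, model_space alpha f ->
    is_proj (model_space beta) (fun z => phi z * f z) (A f).

Definition in_ATTO alpha beta (A : (R[i] -> R[i]) -> (R[i] -> R[i])) : Prop :=
  exists phi, [/\ L2 phi, is_ATTO alpha beta phi A &
                  bounded_map (model_space alpha) A].

Definition blaschke m (a : 'I_m -> R[i]) z : R[i] :=
  \prod_(i < m) ((a i - z) / (1 - (a i)^* * z)).

Definition cderiv f z : R[i] := derive1 (f : R[i]^o -> R[i]^o) z.

Definition matrix_rep m n (a : 'I_m -> R[i]) (b : 'I_n -> R[i])
    (A : (R[i] -> R[i]) -> (R[i] -> R[i])) (t : 'M[R[i]]_(n, m)) : Prop :=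
  forall p : 'I_m,
    circle_eq (A (conj_kernel (blaschke a) (a p)))
      (fun z => \sum_(s < n) t s p * conj_kernel (blaschke b) (b s) z).

(* The families a and b have exactly l values in common, indexed so that these
   are a_i = b_i for i < l (indices start at 0). *)
Definition common_zeros m n (a : 'I_m -> R[i]) (b : 'I_n -> R[i])
    (l : nat) : Prop :=
  #|[pred i : 'I_m | [exists j : 'I_n, a i == b j]]| = l /\
  forall (i : 'I_m) (j : 'I_n), i = j :> nat -> (i < l)%N -> a i = b j.

End UnitCircle.

(* Main.v *)
Require Import Defs.
From HB Require Import structures.
From mathcomp Require Import all_boot all_order all_algebra.
From mathcomp Require Import ring lra.
From mathcomp Require Import complex.
From mathcomp Require Import all_classical all_reals all_analysis.
From mathcomp Require Import measurable_realfun.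

(** Write [k_w = 1 / (1 - conj w * z)] for the Cauchy kernel.  On the circle
    [conj z = 1 / z], hence [conj k_w = z / (z - w)], while the conjugate kernel at a
    zero [a_p] of [alpha] is [alpha / (z - a_p)].  Pairing with the kernels [k_(b_s)]
    extracts the matrix entries, because these kernels are biorthogonal to the
    conjugate kernels of [beta] up to the factors [beta'(b_s)].  Thus for an operator
    [A] with symbol [phi] the number [beta'(b_s) * t_(s,p)] is the mean over the
    circle of [phi * alpha * z / ((z - a_p) * (z - b_s))], and a decomposition into
    partial fractions shows that
      [beta'(b_s) * (a_p - b_s) * t_(s,p) = u_p - v_s]
    for some numbers [u_p] and [v_s] ([in_ATTO_rank2]).

    Conversely, let [t] have this form.  For a polynomial [Q] the symbol
    [conj alpha * Q] has as entries the divided differences of [Q] at [a_p] and [b_s]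
    divided by [beta'(b_s)] ([inner_symbol_entry]).  So a polynomial with
    [Q(a_p) = u_p], [Q(b_s) = v_s] and with prescribed derivatives at the common
    zeros, given by Hermite interpolation, yields [A] ([rank2_in_ATTO]).  The
    formulas of the theorem say that the matrix has the form [u_p - v_s], expressed
    through its first row and column ([rank2_no_common_zero],
    [rank2_common_zeros]).

    The analysis needed is the following.  A function of H^2 is the limit in mean
    square of its Taylor polynomials; since it is given by radial limits, this is
    proved with Fatou's lemma ([H2_tail_bound]).  So scalar products with functions
    of H^2 are controlled by those with powers of [z] ([H2_orthogonal]), and the mean
    of [z * f * g] vanishes for [f] and [g] in H^2 ([H2_circle_int_mul]).  This gives
    the evaluation property of the kernels ([inner_kernel]) and puts the kernels in
    the model space.  The model space is then the space of fractions
    [P / prod_i (1 - conj a_i * z)] with [deg P < m] for [m] zeros ([model_spaceP]),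
    spanned by the kernels as well as by the conjugate kernels
    ([kernel_expansion], [conj_kernel_expansion]); an operator between model spaces
    is therefore determined by the pairings computed above. *)

Import Order.TTheory GRing.Theory Num.Theory.
Import numFieldNormedType.Exports.

Local Open Scope ring_scope.

(** * The modulus and the unit circle *)

Section CircleIntegral.
Local Set Implicit Arguments.
Local Unset Strict Implicit.
Local Open Scope classical_set_scope.
Local Open Scope complex_scope.
Local Open Scope ring_scope.

Context {R : realType}.
Implicit Types (f g h : R[i] -> R[i]) (z w c : R[i]) (t : R).

Local Notation mu := (@lebesgue_measure R).
Local Notation Re := complex.Re.
Local Notation Im := complex.Im.

Lemma absE z : abs z = Num.sqrt (Re z ^+ 2 + Im z ^+ 2).
Proof. by rewrite /abs normc_def. Qed.

Lemma abs_sqr z : abs z ^+ 2 = Re z ^+ 2 + Im z ^+ 2.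
Proof. by rewrite absE sqr_sqrtr// addr_ge0// sqr_ge0. Qed.

Lemma abs_ge0 z : 0 <= abs z.
Proof. by rewrite absE sqrtr_ge0. Qed.

Lemma norm_abs z : `|z| = (abs z)%:C.
Proof. by rewrite /abs normc_def. Qed.

Lemma absM z w : abs (z * w) = abs z * abs w.
Proof.
have := normrM z w; rewrite !norm_abs -rmorphM/=.
exact: (fmorph_inj (real_complex R)).
Qed.

Lemma absD z w : abs (z + w) <= abs z + abs w.
Proof. by have := ler_normD z w; rewrite !norm_abs -rmorphD/= lecR. Qed.

Lemma absN z : abs (- z) = abs z.
Proof. by rewrite /abs normrN. Qed.

Lemma abs0 : abs (0 : R[i]) = 0.
Proof. by rewrite /abs normr0. Qed.

Lemma abs1 : abs (1 : R[i]) = 1.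
Proof. by rewrite /abs normr1. Qed.

Lemma abs_eq0 z : (abs z == 0) = (z == 0).
Proof.
rewrite -[in RHS]normr_eq0 norm_abs.
by rewrite -(fmorph_eq0 (real_complex R)).
Qed.

Lemma absV z : abs z^-1 = (abs z)^-1.
Proof.
apply: (fmorph_inj (real_complex R)).
by rewrite fmorphV/= -!norm_abs normfV.
Qed.

Lemma absX z n : abs (z ^+ n) = abs z ^+ n.
Proof. by elim: n => [|n IH]; rewrite ?expr0 ?abs1// !exprS absM IH. Qed.

Lemma abs_conj z : abs z^* = abs z.
Proof. by case: z => x y; rewrite !absE /= sqrrN. Qed.

Lemma conjM z w : (z * w)^* = z^* * w^*.
Proof. exact: rmorphM. Qed.

Lemma conjB z w : (z - w)^* = z^* - w^*.
Proof. exact: rmorphB. Qed.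

Lemma conjX z n : (z ^+ n)^* = z^* ^+ n.
Proof. exact: rmorphXn. Qed.

Lemma conj_sum (I : Type) (r : seq I) (P : pred I) (F : I -> R[i]) :
  (\sum_(i <- r | P i) F i)^* = \sum_(i <- r | P i) (F i)^*.
Proof. exact: rmorph_sum. Qed.

Lemma conj_prod (I : Type) (r : seq I) (P : pred I) (F : I -> R[i]) :
  (\prod_(i <- r | P i) F i)^* = \prod_(i <- r | P i) (F i)^*.
Proof. exact: rmorph_prod. Qed.

Lemma mul_conj z : z * z^* = (abs z ^+ 2)%:C.
Proof. by case: z => x y; rewrite abs_sqr; simpc; rewrite -!expr2 mulrC addNr. Qed.

Lemma Re_le_abs z : `|Re z| <= abs z.
Proof. by rewrite absE -sqrtr_sqr ler_wsqrtr// lerDl sqr_ge0. Qed.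

Lemma Im_le_abs z : `|Im z| <= abs z.
Proof. by rewrite absE -sqrtr_sqr ler_wsqrtr// lerDr sqr_ge0. Qed.

Lemma ReD z w : Re (z + w) = Re z + Re w.
Proof. by case: z; case: w. Qed.

Lemma ImD z w : Im (z + w) = Im z + Im w.
Proof. by case: z; case: w. Qed.

Lemma ReM z w : Re (z * w) = Re z * Re w - Im z * Im w.
Proof. by case: z; case: w. Qed.

Lemma ImM z w : Im (z * w) = Re z * Im w + Im z * Re w.
Proof. by case: z; case: w. Qed.

Lemma abs_expi t : abs (expi t) = 1.
Proof. by rewrite absE/= cos2Dsin2 sqrtr1. Qed.

Lemma expi_conj t : expi t * (expi t)^* = 1.
Proof. by rewrite mul_conj abs_expi expr1n. Qed.

Lemma expi_neq0 t : expi t != 0.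
Proof. by rewrite -abs_eq0 abs_expi oner_eq0. Qed.

Lemma expiX t n : expi t ^+ n = expi (n%:R * t).
Proof.
elim: n => [|n IH]; first by rewrite expr0 mul0r /expi cos0 sin0.
rewrite exprS IH -natr1 mulrDl mul1r addrC /expi; simpc.
by rewrite cosD sinD [cos t * sin _ + _]addrC.
Qed.

(** * Measurable and bounded functions on the circle *)

Definition circle_measurable f :=
  measurable_fun angles (fun t => Re (f (expi t))) /\
  measurable_fun angles (fun t => Im (f (expi t))).

Definition circle_bounded f :=
  circle_measurable f /\ exists M, forall t, abs (f (expi t)) <= M.

Definition circle_integrable f :=
  mu.-integrable angles (EFin \o (fun t => Re (f (expi t)))) /\
  mu.-integrable angles (EFin \o (fun t => Im (f (expi t)))).

Lemma measurable_angles : measurable (@angles R : set (measurableTypeR R)).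
Proof. exact: measurable_itv. Qed.
Hint Resolve measurable_angles : core.

Lemma circle_measurable_ext f g : (forall t, f (expi t) = g (expi t)) ->
  circle_measurable f -> circle_measurable g.
Proof.
by move=> fg; rewrite /circle_measurable; under eq_fun do rewrite fg;
  under [X in _ /\ measurable_fun _ X -> _]eq_fun do rewrite fg.
Qed.

Lemma circle_measurableD f g : circle_measurable f -> circle_measurable g ->
  circle_measurable (fun z => f z + g z).
Proof.
move=> [f1 f2] [g1 g2]; split.
  under eq_fun do rewrite ReD; exact: measurable_funD.
under eq_fun do rewrite ImD; exact: measurable_funD.
Qed.

Lemma circle_measurableM f g : circle_measurable f -> circle_measurable g ->
  circle_measurable (fun z => f z * g z).
Proof.
move=> [f1 f2] [g1 g2]; split.
  under eq_fun do rewrite ReM.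
  by apply: measurable_funB; apply: measurable_funM.
under eq_fun do rewrite ImM.
by apply: measurable_funD; apply: measurable_funM.
Qed.

Lemma circle_measurable_conj f : circle_measurable f ->
  circle_measurable (fun z => (f z)^*).
Proof.
move=> [f1 f2]; split.
  rewrite (_ : (fun _ => _) = (fun t => Re (f (expi t))))//.
  by apply/funext => t; case: (f _).
rewrite (_ : (fun _ => _) = (fun t => - Im (f (expi t)))).
  exact: measurableT_comp.
by apply/funext => t; case: (f _).
Qed.

Lemma circle_measurable_cst c : circle_measurable (fun=> c).
Proof. by split; exact: measurable_cst. Qed.

Lemma circle_measurable_id : circle_measurable (fun z => z).
Proof.
split; apply: measurable_funTS; apply: continuous_measurable_fun.
  exact: continuous_cos.
exact: continuous_sin.
Qed.

Lemma measurable_abs_sqr f : circle_measurable f ->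
  measurable_fun angles (fun t => abs (f (expi t)) ^+ 2).
Proof.
move=> [f1 f2]; under eq_fun do rewrite abs_sqr.
by apply: measurable_funD; apply: measurable_funX.
Qed.

(** Since [z^-1 = conj z / |z|^2], only the inverse of a positive real function
    is at stake, and it is [exp (- ln x)]. *)
Lemma circle_measurableV f : circle_measurable f ->
  (forall t, f (expi t) != 0) -> circle_measurable (fun z => (f z)^-1).
Proof.
move=> mf f0.
have mw : measurable_fun angles (fun t => (abs (f (expi t)) ^+ 2)^-1).
  rewrite (_ : (fun _ => _) = (fun t => expR (- ln (abs (f (expi t)) ^+ 2)))).
    apply: measurableT_comp => //; apply: measurableT_comp => //.
    apply: measurableT_comp; first exact: measurable_ln.
    exact: measurable_abs_sqr.
  apply/funext => t; rewrite expRN lnK// posrE exprn_gt0// lt_neqAle abs_ge0.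
  by rewrite eq_sym abs_eq0 f0.
have {}mw : circle_measurable (fun z => ((abs (f z) ^+ 2)^-1)%:C).
  by split=> //=; exact: measurable_cst.
apply: circle_measurable_ext (circle_measurableM (circle_measurable_conj mf) mw).
move=> t /=; rewrite fmorphV /= -mul_conj invfM mulrCA mulfV ?mulr1//.
by rewrite conjC_eq0 f0.
Qed.

Lemma circle_bounded_measurable f : circle_bounded f -> circle_measurable f.
Proof. by case. Qed.

Lemma circle_bounded_ext f g : (forall t, f (expi t) = g (expi t)) ->
  circle_bounded f -> circle_bounded g.
Proof.
move=> fg [mf [M fM]]; split; first exact: circle_measurable_ext fg mf.
by exists M => t; rewrite -fg.
Qed.

Lemma circle_boundedD f g : circle_bounded f -> circle_bounded g ->
  circle_bounded (fun z => f z + g z).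
Proof.
move=> [mf [M fM]] [mg [N gN]]; split; first exact: circle_measurableD.
by exists (M + N) => t; rewrite (le_trans (absD _ _))// lerD.
Qed.

Lemma circle_boundedM f g : circle_bounded f -> circle_bounded g ->
  circle_bounded (fun z => f z * g z).
Proof.
move=> [mf [M fM]] [mg [N gN]]; split; first exact: circle_measurableM.
by exists (M * N) => t; rewrite absM ler_pM// abs_ge0.
Qed.

Lemma circle_bounded_conj f : circle_bounded f ->
  circle_bounded (fun z => (f z)^*).
Proof.
move=> [mf [M fM]]; split; first exact: circle_measurable_conj.
by exists M => t; rewrite abs_conj.
Qed.

Lemma circle_bounded_cst c : circle_bounded (fun=> c).
Proof. by split; [exact: circle_measurable_cst|exists (abs c)]. Qed.

Lemma circle_bounded_id : circle_bounded (fun z => z).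
Proof.
by split; [exact: circle_measurable_id|exists 1 => t; rewrite abs_expi].
Qed.

Lemma circle_boundedX n : circle_bounded (fun z => z ^+ n).
Proof.
elim: n => [|n IH]; first exact: circle_bounded_cst.
apply: circle_bounded_ext (circle_boundedM circle_bounded_id IH) => t.
by rewrite exprS.
Qed.

Lemma circle_bounded_sum (I : Type) (r : seq I) (F : I -> R[i] -> R[i]) :
  (forall i, circle_bounded (F i)) ->
  circle_bounded (fun z => \sum_(i <- r) F i z).
Proof.
move=> bF; elim: r => [|i r IH].
  apply: circle_bounded_ext (circle_bounded_cst 0) => t.
  by rewrite big_nil.
apply: circle_bounded_ext (circle_boundedD (bF i) IH) => t.
by rewrite big_cons.
Qed.

Lemma circle_bounded_horner (P : {poly R[i]}) : circle_bounded (horner P).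
Proof.
elim/poly_ind: P => [|P c IH].
  by apply: circle_bounded_ext (circle_bounded_cst 0) => t; rewrite horner0.
apply: circle_bounded_ext (circle_boundedD
  (circle_boundedM IH circle_bounded_id) (circle_bounded_cst c)) => t.
by rewrite hornerMXaddC.
Qed.

(** * The space L^2 and the integral *)

Lemma L2_measurable f : L2 f -> circle_measurable f.
Proof. by case. Qed.

Lemma integrable_cst_angles (x : R) :
  mu.-integrable angles (EFin \o (fun=> x)).
Proof.
apply: measurable_bounded_integrable => //.
  by rewrite /angles/= lebesgue_measure_itv/=; case: ifP => // _; rewrite ltry.
by exists `|x|; split; [exact: num_real|move=> y xy t _; exact: ltW].
Qed.

Lemma L2_integrable_sqr f : L2 f ->
  mu.-integrable angles (EFin \o (fun t => abs (f (expi t)) ^+ 2)).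
Proof. by case. Qed.

Lemma le_L2 f (u : R -> R) : circle_measurable f ->
  mu.-integrable angles (EFin \o u) ->
  (forall t, abs (f (expi t)) ^+ 2 <= u t) -> L2 f.
Proof.
move=> mf iu fu; split; [exact: mf.1|exact: mf.2|].
apply: le_integrable iu => //.
  by apply/measurable_EFinP; exact: measurable_abs_sqr.
move=> t _ /=; rewrite lee_fin ger0_norm ?sqr_ge0//.
by rewrite (le_trans (fu t))// ler_norm.
Qed.

Lemma L2_ext f g : (forall t, f (expi t) = g (expi t)) -> L2 f -> L2 g.
Proof.
move=> fg Lf; apply: le_L2 (L2_integrable_sqr Lf) _.
  exact: circle_measurable_ext fg (L2_measurable Lf).
by move=> t; rewrite fg.
Qed.

Lemma L2_boundedM f g : circle_bounded f -> L2 g -> L2 (fun z => f z * g z).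
Proof.
move=> [mf [M fM]] Lg.
apply: (@le_L2 _ (fun t => M ^+ 2 * abs (g (expi t)) ^+ 2)).
- exact: circle_measurableM mf (L2_measurable Lg).
- have := integrableZl measurable_angles (M ^+ 2) (L2_integrable_sqr Lg).
  by apply: eq_integrable => // t _; rewrite /= EFinM.
- move=> t; rewrite absM exprMn ler_wpM2r ?sqr_ge0//.
  by rewrite ler_pXn2r// nnegrE ?abs_ge0// (le_trans _ (fM t))// abs_ge0.
Qed.

Lemma L2_bounded f : circle_bounded f -> L2 f.
Proof.
move=> [mf [M fM]].
apply: (@le_L2 _ (fun=> M ^+ 2)) => //; first exact: integrable_cst_angles.
move=> t.
by rewrite ler_pXn2r// nnegrE ?abs_ge0// (le_trans _ (fM t))// abs_ge0.
Qed.

Lemma integrable_sumsqr f g : L2 f -> L2 g ->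
  mu.-integrable angles (EFin \o
    (fun t => abs (f (expi t)) ^+ 2 + abs (g (expi t)) ^+ 2)).
Proof.
move=> Lf Lg; have := integrableD measurable_angles
  (L2_integrable_sqr Lf) (L2_integrable_sqr Lg).
by apply: eq_integrable.
Qed.

Lemma L2D f g : L2 f -> L2 g -> L2 (fun z => f z + g z).
Proof.
move=> Lf Lg.
apply: (@le_L2 _ (fun t => 2 * (abs (f (expi t)) ^+ 2 + abs (g (expi t)) ^+ 2))).
- exact: circle_measurableD (L2_measurable Lf) (L2_measurable Lg).
- have := integrableZl measurable_angles 2 (integrable_sumsqr Lf Lg).
  by apply: eq_integrable => // t _; rewrite /= EFinM.
- move=> t; set x := f _; set y := g _.
  apply: (@le_trans _ _ ((abs x + abs y) ^+ 2)).
    by rewrite ler_pXn2r// ?nnegrE ?addr_ge0 ?abs_ge0 ?absD.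
  have := sqr_ge0 (abs x - abs y); rewrite sqrrB sqrrD; lra.
Qed.

Lemma L2Z c f : L2 f -> L2 (fun z => c * f z).
Proof. exact: L2_boundedM (circle_bounded_cst c). Qed.

Lemma L2B f g : L2 f -> L2 g -> L2 (fun z => f z - g z).
Proof.
move=> Lf Lg; apply: L2_ext (L2D Lf (L2Z (-1) Lg)) => t.
by rewrite mulN1r.
Qed.

Lemma L2_conj f : L2 f -> L2 (fun z => (f z)^*).
Proof.
move=> Lf; apply: (le_L2 _ (L2_integrable_sqr Lf)).
  exact: circle_measurable_conj (L2_measurable Lf).
by move=> t; rewrite abs_conj.
Qed.

Lemma L2_sum (I : Type) (r : seq I) (F : I -> R[i] -> R[i]) :
  (forall i, L2 (F i)) -> L2 (fun z => \sum_(i <- r) F i z).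
Proof.
move=> bF; elim: r => [|i r IH].
  apply: L2_ext (L2_bounded (circle_bounded_cst 0)) => t.
  by rewrite big_nil.
apply: L2_ext (L2D (bF i) IH) => t.
by rewrite big_cons.
Qed.

Lemma ge0_mulr_le (x y : R) : 0 <= x -> 0 <= y -> x * y <= x ^+ 2 + y ^+ 2.
Proof. by move=> x0 y0; have := sqr_ge0 (x - y); rewrite sqrrB; nra. Qed.

Lemma circle_integrable_L2M f g : L2 f -> L2 g ->
  circle_integrable (fun z => f z * g z).
Proof.
move=> Lf Lg.
have [m1 m2] := circle_measurableM (L2_measurable Lf) (L2_measurable Lg).
split; apply: le_integrable (integrable_sumsqr Lf Lg) => //;
  try exact/measurable_EFinP.
- move=> t _ /=; rewrite lee_fin [leRHS]ger0_norm ?addr_ge0 ?sqr_ge0//.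
  by rewrite (le_trans (Re_le_abs _))// absM ge0_mulr_le ?abs_ge0.
- move=> t _ /=; rewrite lee_fin [leRHS]ger0_norm ?addr_ge0 ?sqr_ge0//.
  by rewrite (le_trans (Im_le_abs _))// absM ge0_mulr_le ?abs_ge0.
Qed.

Lemma circle_integrable_ext f g : (forall t, f (expi t) = g (expi t)) ->
  circle_integrable f -> circle_integrable g.
Proof.
by move=> fg [f1 f2]; split; [move: f1|move: f2];
  apply: eq_integrable => // t _; rewrite /= fg.
Qed.

Lemma circle_integrable_L2 f : L2 f -> circle_integrable f.
Proof.
move=> Lf; have := circle_integrable_L2M (L2_bounded (circle_bounded_cst 1)) Lf.
by apply: circle_integrable_ext => t; rewrite mul1r.
Qed.

Lemma circle_int_ext f g : (forall t, f (expi t) = g (expi t)) ->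
  circle_int f = circle_int g.
Proof.
by move=> fg; rewrite /circle_int; congr (_ * _ +i* (_ * _));
  apply: eq_Rintegral => t _; rewrite fg.
Qed.

Lemma circle_intD f g : circle_integrable f -> circle_integrable g ->
  circle_int (fun z => f z + g z) = circle_int f + circle_int g.
Proof.
move=> [f1 f2] [g1 g2]; rewrite /circle_int; simpc; rewrite -!mulrDr.
rewrite -!RintegralD//.
by congr (_ * _ +i* (_ * _)); apply: eq_Rintegral => t _; rewrite ?ReD ?ImD.
Qed.

Lemma circle_intZ c f : circle_integrable f ->
  circle_int (fun z => c * f z) = c * circle_int f.
Proof.
move=> [f1 f2]; rewrite /circle_int.
have iZ (k : R) (u : R -> R) : mu.-integrable angles (EFin \o u) ->
    mu.-integrable angles (EFin \o (fun t => k * u t)).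
  move=> /(integrableZl measurable_angles k).
  by apply: eq_integrable.
have e1 : \int[mu]_(t in angles) Re (c * f (expi t)) =
    Re c * \int[mu]_(t in angles) Re (f (expi t)) -
    Im c * \int[mu]_(t in angles) Im (f (expi t)).
  rewrite -!RintegralZl// -RintegralB ?iZ//.
  by apply: eq_Rintegral => t _; rewrite ReM.
have e2 : \int[mu]_(t in angles) Im (c * f (expi t)) =
    Re c * \int[mu]_(t in angles) Im (f (expi t)) +
    Im c * \int[mu]_(t in angles) Re (f (expi t)).
  rewrite -!RintegralZl// -RintegralD ?iZ//.
  by apply: eq_Rintegral => t _; rewrite ImM.
rewrite e1 e2 [c in RHS]complexE; apply/eqP; rewrite eq_complex /=.
by apply/andP; split; apply/eqP; ring.
Qed.

Lemma circle_int_conj f : circle_integrable f ->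
  circle_int (fun z => (f z)^*) = (circle_int f)^*.
Proof.
move=> [f1 f2]; rewrite /circle_int /=; apply/eqP; rewrite eq_complex /=.
apply/andP; split; apply/eqP.
  by congr (_ * _); apply: eq_Rintegral => t _; case: (f _).
rewrite -mulrN -[X in _ = _ * X]mulN1r -[X in _ = _ * X]RintegralZl//; congr (_ * _).
by apply: eq_Rintegral => t _; case: (f _) => x y /=; rewrite mulN1r.
Qed.

Lemma circle_int0 : circle_int (fun=> 0 : R[i]) = 0.
Proof.
by rewrite /circle_int /= Rintegral_cst// !mul0r mulr0.
Qed.

Lemma circle_eq_integral f g : circle_measurable f -> circle_measurable g ->
  circle_eq f g -> circle_int f = circle_int g.
Proof.
move=> [f1 f2] [g1 g2] fg; rewrite /circle_int /Rintegral.
congr (_ * fine _ +i* (_ * fine _)); apply: ae_eq_integral => //;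
  try exact/measurable_EFinP.
- by apply: filterS fg => t /= + Dt => ->.
- by apply: filterS fg => t /= + Dt => ->.
Qed.

End CircleIntegral.

(** * The scalar product and the squared norm *)

Section CircleInnerProduct.
Local Set Implicit Arguments.
Local Unset Strict Implicit.
Local Open Scope classical_set_scope.
Local Open Scope complex_scope.
Local Open Scope ring_scope.

Context {R : realType}.
Local Arguments inner : simpl never.
Local Arguments circle_int : simpl never.
Implicit Types (f g h : R[i] -> R[i]) (z w c : R[i]) (t : R).

Local Notation mu := (@lebesgue_measure R).
Local Notation Re := complex.Re.
Local Notation Im := complex.Im.

Lemma inner_ext f f' g g' : (forall t, f (expi t) = f' (expi t)) ->
  (forall t, g (expi t) = g' (expi t)) -> inner f g = inner f' g'.
Proof. by move=> ff gg; apply: circle_int_ext => t; rewrite ff gg. Qed.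

Lemma circle_integrable_inner f g : L2 f -> L2 g ->
  circle_integrable (fun z => f z * (g z)^*).
Proof. by move=> Lf /L2_conj; exact: circle_integrable_L2M. Qed.

Lemma innerDl f f' g : L2 f -> L2 f' -> L2 g ->
  inner (fun z => f z + f' z) g = inner f g + inner f' g.
Proof.
move=> Lf Lf' Lg; rewrite -circle_intD; try exact: circle_integrable_inner.
by apply: circle_int_ext => t; rewrite mulrDl.
Qed.

Lemma innerZl c f g : L2 f -> L2 g ->
  inner (fun z => c * f z) g = c * inner f g.
Proof.
move=> Lf Lg; rewrite -circle_intZ; last exact: circle_integrable_inner.
by apply: circle_int_ext => t; rewrite mulrA.
Qed.

Lemma inner0l g : inner (fun=> 0) g = 0.
Proof.
apply: etrans (@circle_int0 R).
by apply: circle_int_ext => t; rewrite mul0r.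
Qed.

Lemma inner_conj f g : L2 f -> L2 g -> inner g f = (inner f g)^*.
Proof.
move=> Lf Lg; rewrite -circle_int_conj; last exact: circle_integrable_inner.
by apply: circle_int_ext => t; rewrite rmorphM/= conjCK mulrC.
Qed.

Lemma inner_suml (I : Type) (r : seq I) (F : I -> R[i] -> R[i]) g :
  (forall i, L2 (F i)) -> L2 g ->
  inner (fun z => \sum_(i <- r) F i z) g = \sum_(i <- r) inner (F i) g.
Proof.
move=> LF Lg; elim: r => [|i r IH].
  rewrite big_nil; apply: etrans (inner0l g).
  by apply: inner_ext => // t; rewrite big_nil.
rewrite big_cons -IH -innerDl//; last exact: L2_sum.
by apply: inner_ext => // t; rewrite big_cons.
Qed.

Lemma innerBl f f' g : L2 f -> L2 f' -> L2 g ->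
  inner (fun z => f z - f' z) g = inner f g - inner f' g.
Proof.
move=> Lf Lf' Lg; rewrite -[- inner _ _]mulN1r -innerZl// -innerDl//.
  by apply: inner_ext => // t; rewrite mulN1r.
exact: L2Z.
Qed.

Lemma inner_sumr (I : Type) (r : seq I) (F : I -> R[i] -> R[i]) f :
  (forall i, L2 (F i)) -> L2 f ->
  inner f (fun z => \sum_(i <- r) F i z) = \sum_(i <- r) inner f (F i).
Proof.
move=> LF Lf; rewrite inner_conj//; last exact: L2_sum.
rewrite inner_suml// rmorph_sum/=; apply: eq_bigr => i _.
by rewrite [RHS]inner_conj.
Qed.

Lemma innerZr c f g : L2 f -> L2 g ->
  inner f (fun z => c * g z) = c^* * inner f g.
Proof.
move=> Lf Lg; rewrite inner_conj//; last exact: L2Z.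
by rewrite innerZl// rmorphM/= -inner_conj.
Qed.

Definition sqnorm f : R := (2 * pi)^-1 *
  \int[mu]_(t in angles) (abs (f (expi t)) ^+ 2).

Lemma inner_sqnorm f : inner f f = (sqnorm f)%:C.
Proof.
apply/eqP; rewrite eq_complex /=; apply/andP; split; apply/eqP.
  by congr (_ * _); apply: eq_Rintegral => t _; rewrite mul_conj.
rewrite (_ : \int[mu]_(t in angles) _ = \int[mu]_(t in angles) 0).
  by rewrite Rintegral_cst ?mul0r ?mulr0//; exact: measurable_angles.
by apply: eq_Rintegral => t _; rewrite mul_conj.
Qed.

Lemma twopi_gt0 : 0 < 2 * pi :> R.
Proof. by rewrite mulr_gt0// pi_gt0. Qed.

Lemma sqnorm_ge0 f : 0 <= sqnorm f.
Proof.
rewrite mulr_ge0 ?invr_ge0 ?(ltW twopi_gt0)// Rintegral_ge0// => t _.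
exact: sqr_ge0.
Qed.

Lemma integral_sqnorm f : L2 f ->
  (\int[mu]_(t in angles) (abs (f (expi t)) ^+ 2)%:E =
   (2 * pi * sqnorm f)%:E)%E.
Proof.
move=> Lf; rewrite /sqnorm mulrA mulfV ?gt_eqF ?twopi_gt0// mul1r fineK//.
apply: integrable_fin_num (L2_integrable_sqr Lf).
exact: measurable_angles.
Qed.

Lemma sqnorm_sub c f g : L2 f -> L2 g ->
  sqnorm (fun z => f z - c * g z) =
  sqnorm f - 2 * Re (c^* * inner f g) + abs c ^+ 2 * sqnorm g.
Proof.
move=> Lf Lg; have Lcg := L2Z c Lg; have LB := L2B Lf Lcg.
apply: (fmorph_inj (real_complex R)).
rewrite /= -inner_sqnorm innerBl// innerZl// [inner f _]inner_conj//.
rewrite [inner g _]inner_conj// !innerBl// !innerZl// !rmorphB/= !rmorphM/=.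
rewrite -!inner_conj// !inner_sqnorm [inner g f](inner_conj Lf Lg) /=.
set A := inner f g; move: A => [u v]; case: c {Lcg LB} => x y.
rewrite abs_sqr; move: (sqnorm f) (sqnorm g) => p q; simpc => /=.
by apply/eqP; rewrite eq_complex/=; apply/andP; split; apply/eqP; ring.
Qed.

(** The Cauchy-Schwarz inequality, with an upper bound in place of the norm of
    [g], so that the bound may be taken positive even when [g] vanishes. *)
Lemma cauchy_schwarz f g (eta : R) : L2 f -> L2 g -> 0 < eta ->
  sqnorm g <= eta -> abs (inner f g) ^+ 2 <= eta * sqnorm f.
Proof.
move=> Lf Lg e0 ge.
have := sqnorm_ge0 (fun z => f z - (eta^-1%:C * inner f g) * g z).
rewrite sqnorm_sub//. rewrite conjM -mulrA [_^* * inner f g]mulrC mul_conj.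
set A := abs (inner f g).
have -> : (eta^-1)%:C^* = (eta^-1)%:C by exact: conjc_real.
rewrite absM -/A -rmorphM.
have -> : abs (eta^-1)%:C = eta^-1.
  by rewrite absE/= expr0n/= addr0 sqrtr_sqr ger0_norm// invr_ge0 ltW.
move=> H.
have H2 : (eta^-1 * A) ^+ 2 * sqnorm g <= eta^-1 * A ^+ 2.
  rewrite (_ : _ * _ = eta^-1 * A ^+ 2 * (eta^-1 * sqnorm g)); last by ring.
  have q1 : eta^-1 * sqnorm g <= 1 by rewrite mulrC ler_pdivrMr// mul1r.
  by apply: ler_piMr => //; rewrite mulr_ge0 ?sqr_ge0// invr_ge0 ltW.
have : 0 <= eta * (sqnorm f - eta^-1 * A ^+ 2).
  by rewrite mulr_ge0 ?(ltW e0)//; rewrite /= in H; lra.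
by rewrite mulrBr mulVKf ?gt_eqF// subr_ge0.
Qed.

(** * Orthogonality of the powers of z *)

Lemma expi_2pi : expi (2 * pi : R) = 1.
Proof. by rewrite /expi mulr_natl cos2pi sin2pi. Qed.

Lemma Rintegral_FTC (F f : R -> R) : continuous f ->
  (forall x, is_derive x (1 : R) F (f x)) ->
  \int[mu]_(t in angles) f t = F (2 * pi) - F 0.
Proof.
move=> cf dF; rewrite /Rintegral (@continuous_FTC2 _ _ F) ?twopi_gt0//.
- by apply: continuous_subspaceT.
- have cF x : {for x, continuous F}.
    by apply/differentiable_continuous/derivable1_diffP; exact: ex_derive.
  split; first by move=> x _; exact: ex_derive.
    by apply: cvg_at_right_filter; exact: cF.
  by apply: cvg_at_left_filter; exact: cF.
- by move=> x _; rewrite derive1E; exact: derive_val.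
Qed.

Lemma circle_int_expr k : (0 < k)%N -> circle_int (fun z : R[i] => z ^+ k) = 0.
Proof.
move=> k0; have k0' : k%:R != 0 :> R by rewrite pnatr_eq0 -lt0n.
have mulk (x : R) : is_derive x (1 : R) (fun t => k%:R * t) k%:R.
  have := is_deriveZ (k%:R : R) (is_derive_id x (1 : R)).
  by rewrite /GRing.scale/= mulr1.
have ck : continuous (fun t : R => k%:R * t).
  by move=> x; apply: cvgMr; exact: cvg_id.
have per : expi (k%:R * (2 * pi)) = 1 :> R[i] by rewrite -expiX expi_2pi expr1n.
have [cos1 sin0'] : cos (k%:R * (2 * pi)) = 1 :> R /\ sin (k%:R * (2 * pi)) = 0 :> R.
  by move: per; rewrite /expi => -[].
have Icos : \int[mu]_(t in angles) cos (k%:R * t) = 0.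
  have ccos : continuous (fun t : R => cos (k%:R * t)).
    by move=> x; apply: continuous_comp; [exact: ck|exact: continuous_cos].
  have dF x : is_derive x (1 : R) (fun t => k%:R^-1 * sin (k%:R * t)) (cos (k%:R * x)).
    have := is_deriveZ (k%:R^-1 : R)
    (is_derive1_comp (is_derive_sin (k%:R * x)) (mulk x)).
  rewrite /GRing.scale/= /GRing.scale/=.
  by rewrite mulrC mulfK.
  rewrite (Rintegral_FTC ccos dF).
  by rewrite sin0' !mulr0 sin0 mulr0 subrr.
have Isin : \int[mu]_(t in angles) sin (k%:R * t) = 0.
  have csin : continuous (fun t : R => sin (k%:R * t)).
    by move=> x; apply: continuous_comp; [exact: ck|exact: continuous_sin].
  have dF x : is_derive x (1 : R) (fun t => k%:R^-1 * - cos (k%:R * t)) (sin (k%:R * x)).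
    have := is_deriveZ (k%:R^-1 : R)
    (is_deriveN (is_derive1_comp (is_derive_cos (k%:R * x)) (mulk x))).
  rewrite /GRing.scale/= /GRing.scale/=.
  by move=> H; apply: is_derive_eq H _; field.
  rewrite (Rintegral_FTC csin dF).
  by rewrite cos1 mulr0 cos0 subrr.
rewrite /circle_int; apply/eqP; rewrite eq_complex/=; apply/andP; split; apply/eqP.
  rewrite -[RHS](mulr0 (2 * pi)^-1) -Icos; congr (_ * _).
  by apply: eq_Rintegral => t _; rewrite expiX.
rewrite -[RHS](mulr0 (2 * pi)^-1) -Isin; congr (_ * _).
by apply: eq_Rintegral => t _; rewrite expiX.
Qed.

Lemma circle_int1 : circle_int (fun=> 1 : R[i]) = 1.
Proof.
rewrite /circle_int /= !Rintegral_cst; try exact: measurable_angles.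
rewrite mul0r mulr0 mul1r /angles/= lebesgue_measure_itv/= lte_fin twopi_gt0.
by rewrite oppr0 addr0 mulVf// gt_eqF ?twopi_gt0.
Qed.

Lemma expi_expr_conj t j k : (j <= k)%N ->
  expi t ^+ k * (expi t ^+ j)^* = expi t ^+ (k - j).
Proof.
move=> jk; rewrite -{1}(subnK jk) exprD -mulrA rmorphXn/= -exprMn expi_conj.
by rewrite expr1n mulr1.
Qed.

Lemma L2_expr k : L2 (fun z : R[i] => z ^+ k).
Proof. exact/L2_bounded/circle_boundedX. Qed.

Lemma inner_expr j k :
  inner (fun z : R[i] => z ^+ j) (fun z => z ^+ k) = (j == k)%:R.
Proof.
wlog jk : j k / (k <= j)%N => [H|].
  have [jk|/ltnW kj] := leqP k j; first exact: H.
  by rewrite inner_conj ?H ?rmorph_nat 1?eq_sym//; exact: L2_expr.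
rewrite /inner (@circle_int_ext _ _ (fun z => z ^+ (j - k))); last first.
  by move=> t; rewrite expi_expr_conj.
have [->|jk'] := eqVneq j k; first by rewrite subnn; exact: circle_int1.
by rewrite circle_int_expr// subn_gt0 ltn_neqAle eq_sym jk'.
Qed.

Lemma sqnorm_pythagoras (c : nat -> R[i]) N M : (N <= M)%N ->
  sqnorm (fun z => \sum_(N <= k < M) c k * z ^+ k) =
  \sum_(N <= k < M) abs (c k) ^+ 2.
Proof.
have Lc k : L2 (fun z => c k * z ^+ k) by apply: L2Z; exact: L2_expr.
move=> NM; apply: (fmorph_inj (real_complex R)).
rewrite /= -inner_sqnorm inner_suml//; last exact: L2_sum.
rewrite rmorph_sum/=; apply: eq_big_nat => i /andP[Ni iM].
rewrite inner_sumr//.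
rewrite (bigD1_seq i) ?iota_uniq ?mem_index_iota ?Ni//=.
rewrite big1 => [|j ij]; last first.
  rewrite innerZr//; last exact: L2_expr.
  rewrite innerZl ?inner_expr; try exact: L2_expr.
  by rewrite eq_sym (negPf ij) !mulr0.
rewrite addr0 innerZr//; last exact: L2_expr.
rewrite innerZl ?inner_expr ?eqxx ?mulr1; try exact: L2_expr.
by rewrite mulrC mul_conj.
Qed.

End CircleInnerProduct.

(** * Density of the polynomials in H^2 *)

Section PolynomialLimits.
Local Set Implicit Arguments.
Local Unset Strict Implicit.
Local Open Scope classical_set_scope.
Local Open Scope ring_scope.

Lemma cvg_pow (K : numFieldType) (T : Type) (G : set_system T) {FG : Filter G}
    (u : T -> K^o) (l : K^o) k :
  u x @[x --> G] --> l -> (u x ^+ k : K^o) @[x --> G] --> (l ^+ k : K^o).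
Proof.
move=> ul; elim: k => [|k IH].
  by rewrite expr0; under eq_fun do rewrite expr0; exact: cvg_cst.
rewrite exprS; under eq_fun do rewrite exprS.
exact: cvgM.
Qed.
Lemma cvg_sum_expr (K : numFieldType) (T : Type) (G : set_system T) {FG : Filter G}
    (c : nat -> K) N (u : T -> K^o) (l : K^o)  :
  u x @[x --> G] --> l ->
  (\sum_(0 <= k < N) c k * u x ^+ k : K^o) @[x --> G] -->
  (\sum_(0 <= k < N) c k * l ^+ k : K^o).
Proof.
move=> ul; elim: N => [|N IH].
  rewrite big_nil; under eq_fun do rewrite big_nil; exact: cvg_cst.
rewrite big_nat_recr//=; under eq_fun do rewrite big_nat_recr//=.
apply: cvgD => //; apply: cvgM; [exact: cvg_cst|exact: cvg_pow].
Qed.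

End PolynomialLimits.

Section HardyDensity.
Local Set Implicit Arguments.
Local Unset Strict Implicit.
Local Open Scope classical_set_scope.
Local Open Scope complex_scope.
Local Open Scope ring_scope.

Context {R : realType}.
Implicit Types (f g h : R[i] -> R[i]) (z w c : R[i]) (t : R).

Local Notation mu := (@lebesgue_measure R).
Local Arguments inner : simpl never.
Local Arguments circle_int : simpl never.

(** The almost everywhere limit [g] agrees almost everywhere with the lower limit
    of [f], to which Fatou's lemma applies. *)
Lemma fatou_le (f : nat -> R -> \bar R) (g : R -> \bar R) (K : \bar R) :
  (forall n, measurable_fun (angles : set (measurableTypeR R)) (f n)) ->
  (forall n t, (0 <= f n t)%E) ->
  measurable_fun (angles : set (measurableTypeR R)) g ->
  {ae mu, forall t, angles t -> f ^~ t @ \oo --> g t} ->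
  (forall n, \int[mu]_(t in angles) f n t <= K)%E ->
  (\int[mu]_(t in angles) g t <= K)%E.
Proof.
move=> mf f0 mg fg fK.
have mlim : measurable_fun (angles : set (measurableTypeR R))
    (fun t => limn_einf (f ^~ t)).
  apply: measurableT_comp => //; apply: measurable_fun_limn_esup => n.
  exact: measurableT_comp.
have -> : (\int[mu]_(t in angles) g t =
           \int[mu]_(t in angles) limn_einf (f ^~ t))%E.
  apply: ae_eq_integral => //; first exact: measurable_angles.
  apply: negligibleS fg => t /= nft ft; apply: nft => Dt.
  by rewrite (cvg_limn_einf_sup (ft Dt)).1.
apply: (le_trans (fatou mu measurable_angles mf (fun n t _ => f0 n t))).
rewrite limn_einf_lim; apply: lime_le; first exact: is_cvg_einfs.
apply: nearW => n; apply: (le_trans _ (fK n)).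
by apply: ereal_inf_lbound; exists n => /=.
Qed.

Lemma cvg_abs_sqr (T : Type) (G : set_system T) {FG : Filter G}
    (u : T -> R[i]) (l w : R[i]) :
  (u x : R[i]^o) @[x --> G] --> (l : R[i]^o) ->
  (abs (u x - w) ^+ 2) @[x --> G] --> abs (l - w) ^+ 2.
Proof.
move=> ul; rewrite expr2; under eq_fun do rewrite expr2.
have H : abs (u x - w) @[x --> G] --> abs (l - w).
  apply/cvgrPdist_lt => e e0.
  have e0' : 0 < e%:C :> R[i] by rewrite ltcR.
  move/cvgrPdist_lt: ul => /(_ _ e0'); apply: filterS => x.
  rewrite norm_abs ltcR => H; apply: (le_lt_trans _ H).
  rewrite ler_norml; apply/andP; split.
    have := absD (l - w) (u x - l); rewrite addrC addrA subrK.
    rewrite -[u x - l]opprB absN; lra.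
  have := absD (u x - w) (l - u x); rewrite addrC addrA subrK; lra.
exact: cvgM.
Qed.

Lemma cvg_radial t : (r%:C * expi t : R[i]^o) @[r --> (1 : R)^'-] --> (expi t : R[i]^o).
Proof.
apply: cvg_at_left_filter; apply/cvgrPdist_lt => e; rewrite ltcE /= => /andP[/eqP e1 e0].
have E : e = (complex.Re e)%:C by rewrite {1}(complexE e) e1 rmorph0 mulr0 addr0.
have /cvgrPdist_lt /(_ _ e0) : x @[x --> (1 : R)] --> (1 : R) by exact: cvg_id.
apply: filterS => x x1.
rewrite E norm_abs ltcR -{1}[expi t]mul1r -mulrBl absM abs_expi mulr1.
by rewrite -(rmorph1 (real_complex R)) -rmorphB absE /= expr0n addr0 sqrtr_sqr.
Qed.

(** On each circle of radius [r < 1] the Taylor polynomials converge pointwise and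
    satisfy the bound by Pythagoras, so Fatou's lemma gives it for [F]; Fatou's
    lemma along [r --> 1] then gives it for the boundary function. *)
Lemma H2_tail_bound h (c : nat -> R[i]) (F : R[i] -> R[i]) N (e : R) :
  L2 h ->
  (forall z, in_disk z ->
    (series (fun k => c k * z ^+ k) : nat -> R[i]^o) @ \oo --> (F z : R[i]^o)) ->
  {ae mu, forall t, angles t ->
    (F (r%:C * expi t) : R[i]^o) @[r --> (1 : R)^'-] --> (h (expi t) : R[i]^o)} ->
  (forall M, (N <= M)%N -> \sum_(N <= k < M) abs (c k) ^+ 2 <= e) ->
  sqnorm (fun z => h z - \sum_(0 <= k < N) c k * z ^+ k) <= e.
Proof.
move=> Lh cF Fh ce.
have LS M N' (d : nat -> R[i]) : L2 (fun z => \sum_(M <= k < N') d k * z ^+ k).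
  by apply: L2_sum => k; apply: L2Z; exact: L2_expr.
have LhS := L2B Lh (LS 0%N N c).
have mea f : L2 f -> measurable_fun (angles : set (measurableTypeR R))
    (fun t => (abs (f (expi t)) ^+ 2)%:E).
  by move=> Lf; apply/measurable_EFinP; exact: measurable_abs_sqr (L2_measurable Lf).
pose r (j : nat) : R := 1 - j.+1%:R^-1.
have r0 j : 0 <= r j by rewrite subr_ge0 invf_le1// ler1n.
have r1 j : r j < 1 by rewrite ltrBlDr ltrDl invr_gt0.
have absr j t : abs ((r j)%:C * expi t) = r j.
  by rewrite absM abs_expi mulr1 absE/= expr0n/= addr0 sqrtr_sqr ger0_norm.
pose p j M z := \sum_(N <= k < N + M) (c k * (r j)%:C ^+ k) * z ^+ k.
pose G j t : R := abs (F ((r j)%:C * expi t) -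
   \sum_(0 <= k < N) c k * ((r j)%:C * expi t) ^+ k) ^+ 2.
have pG j t : (abs (p j M (expi t)) ^+ 2)%:E @[M --> \oo] --> (G j t)%:E.
  have zD : in_disk ((r j)%:C * expi t) by rewrite /in_disk absr.
  have H := cvg_abs_sqr
    (w := \sum_(0 <= k < N) c k * ((r j)%:C * expi t) ^+ k) (cF _ zD).
  apply: cvg_EFin; first exact: nearW.
  have := cvg_comp _ _ (cvg_addnl N) (H eventually_filter); apply: cvg_trans.
  apply: near_eq_cvg; apply: nearW => M /=; congr (abs _ ^+ 2).
  rewrite /series/= (big_cat_nat (n := N)) ?leq_addr//=. rewrite [_ - _]addrAC subrr add0r.
  by apply: eq_bigr => k _; rewrite exprMn mulrA.
have mp j M : measurable_fun (angles : set (measurableTypeR R))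
    (fun t => (abs (p j M (expi t)) ^+ 2)%:E) by apply: mea; exact: LS.
have mG j : measurable_fun (angles : set (measurableTypeR R)) (fun t => (G j t)%:E).
  apply: (emeasurable_fun_cvg (fun M t => (abs (p j M (expi t)) ^+ 2)%:E)).
    exact: mp.
  by move=> t _; exact: pG.
have Gle j : (\int[mu]_(t in angles) (G j t)%:E <= (2 * pi * e)%:E)%E.
  apply: (fatou_le (mp j)) => //.
  - by move=> n t; rewrite lee_fin sqr_ge0.
  - by apply: aeW => t _; exact: pG.
  - move=> M; rewrite integral_sqnorm; last exact: LS.
    rewrite lee_fin ler_wpM2l ?(ltW (twopi_gt0))//.
    rewrite sqnorm_pythagoras ?leq_addr//.
    apply: le_trans (ce (N + M)%N (leq_addr _ _)).
    apply: ler_sum => k _; rewrite absM exprMn ler_piMr ?sqr_ge0//.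
    rewrite absX -exprM absE/= expr0n/= addr0 sqrtr_sqr ger0_norm//.
    by rewrite exprn_ile1// ltW.
have rcvg : r @ \oo --> (1 : R)^'-.
  have r1' : r @ \oo --> (1 : R).
    rewrite -[X in _ --> X]subr0; apply: cvgB; first exact: cvg_cst.
    exact: cvg_harmonic.
  move=> U H; have H' : \forall j \near \oo, r j < 1 -> U (r j) := r1' _ H.
  have : \forall j \near \oo, U (r j) by apply: filterS H' => j Hj; exact: Hj.
  exact.
have : (\int[mu]_(t in angles)
    (abs (h (expi t) - \sum_(0 <= k < N) c k * expi t ^+ k) ^+ 2)%:E <=
    (2 * pi * e)%:E)%E.
  apply: (fatou_le mG) => //.
  - by move=> n t; rewrite lee_fin sqr_ge0.
  - exact: mea LhS.
  - apply: negligibleS Fh => t /= nft ft; apply: nft => Dt.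
    apply: cvg_EFin; first exact: nearW.
    have H1 := cvg_comp _ _ rcvg (ft Dt).
    have H2 := cvg_comp _ _ rcvg (@cvg_radial t).
    have H3 : (F ((r j)%:C * expi t) -
        \sum_(0 <= k < N) c k * ((r j)%:C * expi t) ^+ k : R[i]^o) @[j --> \oo] -->
        (h (expi t) - \sum_(0 <= k < N) c k * expi t ^+ k : R[i]^o).
      by apply: cvgB; [exact: H1|exact: cvg_sum_expr].
    have H4 := cvg_abs_sqr (w := 0) H3.
    have := H4 eventually_filter; rewrite subr0; apply: cvg_trans.
    apply: near_eq_cvg; apply: nearW => j /=.
    by rewrite subr0.
by rewrite (integral_sqnorm LhS) lee_fin ler_pM2l// twopi_gt0.
Qed.

(** This is the density of the polynomials in H^2, in dual form: replacing [h] by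
    [h - S_N], with [S_N] a Taylor polynomial, does not change the scalar product,
    and the norm of [h - S_N] is small by [H2_tail_bound]. *)
Lemma H2_orthogonal h g : H2 h -> L2 g ->
  (forall j, inner (fun z => z ^+ j) g = 0) -> inner h g = 0.
Proof.
move=> [Lh [c [F [cc cF Fh]]]] Lg g0.
pose d k := abs (c k) ^+ 2.
have dk k : 0 <= d k by exact: sqr_ge0.
pose S N z := \sum_(0 <= k < N) c k * z ^+ k.
have LS N : L2 (S N) by apply: L2_sum => k; apply: L2Z; exact: L2_expr.
have hS N : inner h g = inner (fun z => h z - S N z) g.
  rewrite innerBl// inner_suml//; last first.
    by move=> k; apply: L2Z; exact: L2_expr.
  rewrite big1 ?subr0// => k _; rewrite innerZl ?g0 ?mulr0//; exact: L2_expr.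
have small (e : R) : 0 < e -> exists N, sqnorm (fun z => h z - S N z) <= e.
  move=> e0; have [N _ HN] : \forall N \near \oo,
      `|limn (series d) - series d N| < e.
    by move/cvgrPdist_lt: cc; exact.
  exists N; apply: (H2_tail_bound Lh cF Fh) => M NM.
  have nd : nondecreasing_seq (series d).
    by apply: nondecreasing_series => k _ _; exact: dk.
  have := nondecreasing_cvgn_le nd cc M.
  have := HN N (leqnn N); rewrite /= ltr_norml => /andP[_].
  rewrite [series d M](big_cat_nat (n := N))//= -/(series d N) => H1 H2.
  rewrite -lerBrDl in H2; apply: (le_trans H2); exact: ltW.
apply/eqP; rewrite -abs_eq0 -sqrf_eq0 eq_le sqr_ge0 andbT.
apply/ler_addgt0Pl => e e0; rewrite addr0.
have K0 : 0 < sqnorm g + 1 by rewrite ltr_wpDl// sqnorm_ge0.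
have [N HN] := small (e / (sqnorm g + 1)) (divr_gt0 e0 K0).
rewrite (hS N) (inner_conj Lg (L2B Lh (LS N))) abs_conj.
apply: le_trans (cauchy_schwarz Lg (L2B Lh (LS N)) (divr_gt0 e0 K0) HN) _.
by rewrite -mulrA ger_pMr// mulrC ler_pdivrMr// mul1r lerDl.
Qed.

End HardyDensity.

(** * Functions of H^2 *)

Section HardySpace.
Local Set Implicit Arguments.
Local Unset Strict Implicit.
Local Open Scope classical_set_scope.
Local Open Scope complex_scope.
Local Open Scope ring_scope.

Context {R : realType}.
Implicit Types (f g h : R[i] -> R[i]) (z w c : R[i]) (t : R).

Local Notation mu := (@lebesgue_measure R).
Local Arguments inner : simpl never.
Local Arguments circle_int : simpl never.

Lemma H2_L2 f : H2 f -> L2 f.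
Proof. by case. Qed.

Lemma H2_circle_int_expr f j : H2 f ->
  circle_int (fun z => z ^+ j.+1 * f z) = 0.
Proof.
move=> Hf; have Lg := L2_conj (@L2_expr R j.+1).
have : inner f (fun z => (z ^+ j.+1)^*) = 0.
  apply: H2_orthogonal => // i.
  rewrite -(@circle_int_expr R (i + j.+1)); last by rewrite addnS.
  by apply: circle_int_ext => t; rewrite conjCK exprD.
by move=> <-; apply: circle_int_ext => t; rewrite conjCK mulrC.
Qed.

(** A product of two functions of H^2 has no Fourier coefficient of negative
    index.  Density of the polynomials is used for each factor in turn, so that
    only the means of the powers of [z] have to be known. *)
Lemma H2_circle_int_mul f g : H2 f -> H2 g ->
  circle_int (fun z => z * f z * g z) = 0.
Proof.
move=> Hf Hg.
have Lzf := L2_conj (L2_boundedM (circle_bounded_id (R:=R)) (H2_L2 Hf)).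
have : inner g (fun z => (z * f z)^*) = 0.
  apply: H2_orthogonal => // j.
  rewrite -(H2_circle_int_expr j Hf).
  by apply: circle_int_ext => t; rewrite conjCK exprSr mulrA.
by move=> <-; apply: circle_int_ext => t; rewrite conjCK mulrC.
Qed.

Lemma H2_ext f g : (forall t, f (expi t) = g (expi t)) -> H2 f -> H2 g.
Proof.
move=> fg [Lf [c [F [cc cF Fh]]]]; split; first exact: L2_ext fg Lf.
exists c, F; split; [exact: cc|exact: cF|].
by apply: negligibleS Fh => t /=; rewrite fg.
Qed.

Lemma H2D f g : H2 f -> H2 g -> H2 (fun z => f z + g z).
Proof.
move=> [Lf [c [F [cc cF Ff]]]] [Lg [d [G [dd dG Gg]]]].
split; first exact: L2D.
exists (fun k => c k + d k), (fun z => F z + G z); split.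
- have cd := is_cvg_seriesZ (k := 2 : R) (is_cvg_seriesD cc dd).
  apply: (series_le_cvg _ _ _ cd) => n; first exact: sqr_ge0.
    by rewrite mulr_ge0// addr_ge0// sqr_ge0.
  apply: (@le_trans _ _ ((abs (c n) + abs (d n)) ^+ 2)).
    by rewrite ler_pXn2r// ?nnegrE ?addr_ge0 ?abs_ge0 ?absD.
  rewrite [leRHS](_ : _ = 2 * (abs (c n) ^+ 2 + abs (d n) ^+ 2))//.
  have := sqr_ge0 (abs (c n) - abs (d n)); rewrite sqrrB sqrrD; lra.
- move=> z zD; apply: (cvg_trans _ (cvgD (cF z zD) (dG z zD))).
  apply: near_eq_cvg; apply: nearW => n /=.
  by rewrite ?fctE /series/= -big_split; apply: eq_bigr => k _; rewrite mulrDl.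
- have N := negligibleU Ff Gg.
  apply: (negligibleS _ N) => t /= H.
  have [Ff'|nFf] := pselect (angles t ->
    (F (r%:C * expi t) : R[i]^o) @[r --> (1 : R)^'-] --> (f (expi t) : R[i]^o)).
    by right => Gg'; apply: H => Dt; apply: cvgD; [exact: Ff'|exact: Gg'].
  by left.
Qed.

Lemma H2Z c f : H2 f -> H2 (fun z => c * f z).
Proof.
move=> [Lf [d [F [dd dF Ff]]]]; split; first exact: L2Z.
exists (fun k => c * d k), (fun z => c * F z); split.
- rewrite (_ : (fun _ => _) = abs c ^+ 2 *: (fun k => abs (d k) ^+ 2)).
    exact: is_cvg_seriesZ.
  by apply/funext => k; rewrite absM exprMn.
- move=> z zD; apply: (cvg_trans _ (cvgM (cvg_cst (c : R[i]^o)) (dF z zD))).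
  apply: near_eq_cvg; apply: nearW => n /=.
  by rewrite ?fctE /series/= mulr_sumr; apply: eq_bigr => k _; rewrite mulrA.
- apply: negligibleS Ff => t /= H Ff; apply: H => Dt.
  by apply: cvgM; [exact: cvg_cst|exact: Ff].
Qed.

Lemma cvg_absP (T : Type) (G : set_system T) (FG : Filter G)
    (u : T -> R[i]) (l : R[i]) :
  abs (l - u x) @[x --> G] --> 0 -> (u x : R[i]^o) @[x --> G] --> (l : R[i]^o).
Proof.
move=> ul; apply/cvgrPdist_lt => e; rewrite ltcE /= => /andP[/eqP e1 e0].
have E : e = (complex.Re e)%:C by rewrite {1}(complexE e) e1 rmorph0 mulr0 addr0.
move/cvgrPdist_lt : ul => /(_ _ e0); apply: filterS => x.
by rewrite sub0r normrN E norm_abs ltcR ger0_norm// abs_ge0.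
Qed.

Lemma H2_0 : H2 (fun=> 0 : R[i]).
Proof.
split; first exact/L2_bounded/circle_bounded_cst.
exists (fun=> 0), (fun=> 0); split.
- rewrite (_ : series _ = fun=> 0); first exact: is_cvg_cst.
  by apply/funext => n; rewrite /series/= big1// => k _; rewrite abs0 expr0n.
- move=> z _; rewrite (_ : series _ = fun=> 0); first exact: cvg_cst.
  by apply/funext => n; rewrite /series/= big1// => k _; rewrite mul0r.
- by apply: aeW => t _; exact: cvg_cst.
Qed.

Lemma H2_sum (I : Type) (r : seq I) (F : I -> R[i] -> R[i]) :
  (forall i, H2 (F i)) -> H2 (fun z => \sum_(i <- r) F i z).
Proof.
move=> HF; elim: r => [|i r IH].
  by apply: H2_ext H2_0 => t; rewrite big_nil.
by apply: H2_ext (H2D (HF i) IH) => t; rewrite big_cons.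
Qed.

Lemma H2_expr n : H2 (fun z : R[i] => z ^+ n).
Proof.
split; first exact: L2_expr.
exists (fun k => (k == n)%:R), (fun z => z ^+ n).
have sumE (V : pzSemiRingType) (x : nat -> V) m : (n < m)%N ->
    \sum_(0 <= k < m) (k == n)%:R * x k = x n.
  move=> nm; rewrite (bigD1_seq n) ?iota_uniq ?mem_index_iota//= eqxx mul1r.
  by rewrite big1 ?addr0// => k /negPf ->; rewrite mul0r.
split.
- apply: (cvgP (1 : R)); apply: cvg_near_cst; near=> m.
  rewrite /series/= -[RHS](sumE _ (fun=> 1) m); last by near: m; exists n.+1.
  apply: eq_bigr => k _; case: eqP => _; rewrite ?abs1 ?abs0 ?expr1n ?mul1r//.
  by rewrite expr0n mul0r.
- move=> z _; apply: cvg_near_cst; near=> m.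
  rewrite /series/= (sumE _ (fun k => z ^+ k))//; near: m; by exists n.+1.
- by apply: aeW => t _; apply: cvg_pow; exact: cvg_radial.
Unshelve. all: by end_near. Qed.

Lemma H2_horner (P : {poly R[i]}) : H2 (horner P).
Proof.
have := @H2_sum _ (index_iota 0 (size P)) (fun k z => P`_k * z ^+ k).
move=> /(_ (fun k => H2Z _ (H2_expr k))); apply: H2_ext => t.
by rewrite big_mkord horner_coef.
Qed.

(** * Cauchy kernels *)

(** The reproducing kernel of H^2 at [w]. *)
Definition cauchy_kernel w z : R[i] := (1 - w^* * z)^-1.

Lemma kernel_denom_neq0 w z : in_disk w -> abs z <= 1 -> 1 - w^* * z != 0.
Proof.
move=> w1 z1; apply/eqP => /eqP; rewrite subr_eq0 => /eqP E.
have := congr1 (@abs R) E; rewrite abs1 absM abs_conj => E1.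
suff : abs w * abs z < 1 by rewrite -E1 ltxx.
apply: le_lt_trans w1; apply: ler_piMr => //; exact: abs_ge0.
Qed.

Lemma circle_bounded_kernel w : in_disk w -> circle_bounded (cauchy_kernel w).
Proof.
move=> wD; split.
  apply: circle_measurableV.
    apply: circle_bounded_measurable; apply: circle_bounded_ext
      (circle_boundedD (circle_bounded_cst 1) (circle_boundedM
        (circle_bounded_cst (- w^*)) (circle_bounded_id (R:=R)))) => t.
    by rewrite mulNr.
  by move=> t; rewrite kernel_denom_neq0// abs_expi.
have w0 : 0 < 1 - abs w by rewrite subr_gt0.
exists (1 - abs w)^-1 => t; rewrite absV lef_pV2 ?posrE//; last first.
  rewrite lt_neqAle abs_ge0 andbT eq_sym abs_eq0.
  by rewrite kernel_denom_neq0// abs_expi.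
have := absD (1 - w^* * expi t) (w^* * expi t).
rewrite subrK abs1 absM abs_conj abs_expi mulr1; lra.
Qed.

Lemma kernel_conj w t : in_disk w ->
  (cauchy_kernel w (expi t))^* = expi t / (expi t - w).
Proof.
move=> wD; rewrite /cauchy_kernel fmorphV/= conjB rmorph1 conjM conjCK.
have n0 := expi_neq0 t.
have -> : (expi t)^* = (expi t)^-1 by apply: (mulfI n0); rewrite expi_conj mulfV.
rewrite -[1](mulfV n0) -mulrBl invfM invrK mulrC //.
Qed.

Lemma H2_kernel w : in_disk w -> H2 (cauchy_kernel w).
Proof.
move=> wD; split; first exact/L2_bounded/circle_bounded_kernel.
exists (fun k => w^* ^+ k), (cauchy_kernel w); split.
- rewrite (_ : series _ = series (geometric 1 (abs w ^+ 2))).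
    apply: is_cvg_geometric_series.
    by rewrite ger0_norm ?sqr_ge0// exprn_ilt1// abs_ge0.
  congr series; apply/funext => k /=.
  by rewrite absX abs_conj mul1r -!exprM mulnC.
- move=> z zD; apply: cvg_absP.
  have D0 := kernel_denom_neq0 wD (ltW zD).
  set x := w^* * z in D0 *.
  have x1 : abs x < 1.
    rewrite /x absM abs_conj; apply: le_lt_trans zD.
    by rewrite ler_piMl ?abs_ge0// ltW.
  have E n : cauchy_kernel w z - series (fun k => w^* ^+ k * z ^+ k) n = x ^+ n / (1 - x).
    rewrite /cauchy_kernel -/x -[X in X - _](mul1r _) /series/= -[X in _ - X](mulfK D0).
    rewrite -mulrBl; congr (_ / _).
    rewrite big_mkord; under eq_bigr do rewrite -exprMn -/x.
    by have /eqP := subrX1 x n; rewrite subr_eq => /eqP ->; ring.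
  under eq_fun do rewrite E absM absX.
  have H : (abs x ^+ n * abs (1 - x)^-1) @[n --> \oo] --> 0 * abs (1 - x)^-1.
    apply: cvgM; last exact: cvg_cst.
    by apply: cvg_expr; rewrite ger0_norm// abs_ge0.
  by rewrite mul0r in H; exact: H.
- apply: aeW => t _; apply: cvgV.
    by rewrite kernel_denom_neq0// abs_expi.
  apply: cvgB; first exact: cvg_cst.
  by apply: cvgM; [exact: cvg_cst|exact: cvg_radial].
Qed.

End HardySpace.

(** * Polynomial interpolation *)

Section Interpolation.
Local Set Implicit Arguments.
Local Unset Strict Implicit.
Local Open Scope ring_scope.

Context {K : fieldType}.
Implicit Types (P Q : {poly K}).

Lemma hermite_interpolation (s : seq K) (v w : K -> K) : uniq s ->
  exists Q : {poly K}, {in s, forall x, Q.[x] = v x /\ Q^`().[x] = w x}.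
Proof.
elim: s => [|y s IH] /=; first by exists 0.
move=> /andP[ys /IH[Q HQ]].
(* V vanishes to order two on s, so multiples of V leave the data on s alone. *)
pose W := \prod_(x <- s) ('X - x%:P); pose V := W * W.
have Vs x : x \in s -> V.[x] = 0 /\ V^`().[x] = 0.
  move=> xs; have W0 : W.[x] = 0.
    by rewrite /W horner_prod (big_rem x)//= hornerXsubC subrr mul0r.
  by rewrite /V derivM hornerD !hornerM W0 !mul0r mulr0 addr0.
have Vy : V.[y] != 0.
  rewrite /V hornerM mulf_neq0// horner_prod prodf_seq_neq0;
    apply/allP => x xs /=; rewrite hornerXsubC subr_eq0;
    by apply: contraNneq ys => ->.
clearbody V.
pose c := (v y - Q.[y]) / V.[y].
pose d := (w y - Q^`().[y] - c * V^`().[y]) / V.[y].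
exists (Q + (c%:P + d *: ('X - y%:P)) * V) => x.
rewrite inE => /predU1P[->|xs].
  have Ly : (c%:P + d *: ('X - y%:P)).[y] = c.
    by rewrite hornerD hornerZ hornerXsubC subrr mulr0 addr0 hornerC.
  have L' : (c%:P + d *: ('X - y%:P))^`() = d%:P.
    by rewrite derivD derivC derivZ derivXsubC add0r alg_polyC.
  rewrite derivD derivM L' !hornerD !hornerM Ly hornerC.
  split; first by rewrite [c * _]divfK//; ring.
  by rewrite [d * _]divfK//; ring.
have [V0 V'0] := Vs x xs; have [Qx Q'x] := HQ x xs.
by rewrite derivD derivM !hornerE/= V0 V'0 !mulr0 !addr0.
Qed.

Context {m : nat} (a : 'I_m.+1 -> K).

Definition node_cofactor p : {poly K} := \prod_(i | i != p) ('X - (a i)%:P).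

Lemma size_node_cofactor p : size (node_cofactor p) = m.+1.
Proof.
rewrite /node_cofactor -big_filter size_prod_XsubC; congr _.+1.
by rewrite -sum1_size big_filter sum1_card cardC1 card_ord.
Qed.

Hypothesis a_inj : injective a.

Lemma node_cofactor_eq0 p q : q != p -> (node_cofactor p).[a q] = 0.
Proof.
by move=> qp; rewrite horner_prod (bigD1 q)//= hornerXsubC subrr mul0r.
Qed.

Lemma node_cofactor_neq0 p : (node_cofactor p).[a p] != 0.
Proof.
rewrite horner_prod; apply/prodf_neq0 => i ip.
by rewrite hornerXsubC subr_eq0 (inj_eq a_inj) eq_sym.
Qed.

Lemma lagrange_interpolation P : (size P <= m.+1)%N ->
  P = \sum_p (P.[a p] / (node_cofactor p).[a p]) *: node_cofactor p.
Proof.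
move=> sP; apply/eqP; rewrite -subr_eq0; apply/eqP.
apply: (@roots_geq_poly_eq0 _ _ [seq a p | p : 'I_m.+1]).
- apply/allP => _ /mapP[p _ ->]; rewrite rootE !hornerE horner_sum (bigD1 p)//=.
  rewrite big1 => [|q qp]; last first.
    by rewrite hornerZ (@node_cofactor_eq0 q p) 1?eq_sym// mulr0.
  by rewrite hornerZ divfK ?node_cofactor_neq0// addr0 subrr.
- by rewrite map_inj_uniq ?enum_uniq.
- rewrite size_map -cardE card_ord (leq_trans (size_polyD _ _))// geq_max sP.
  rewrite size_polyN (leq_trans (size_sum _ _ _))//.
  apply/bigmax_leqP => p _; rewrite (leq_trans (size_scale_leq _ _))//.
  by rewrite size_node_cofactor.
Qed.

End Interpolation.

(** * Finite Blaschke products as fractions *)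

Section BlaschkeAlgebra.
Local Set Implicit Arguments.
Local Unset Strict Implicit.
Local Open Scope complex_scope.
Local Open Scope ring_scope.

Context {R : realType} {m : nat} (a : 'I_m.+1 -> R[i]).
Hypothesis a_disk : forall i, in_disk (a i).
Implicit Types (z w : R[i]) (t : R) (P : {poly R[i]}).

Definition blaschke_num : {poly R[i]} := \prod_i ((a i)%:P - 'X).
Definition blaschke_den : {poly R[i]} := \prod_i (1 - (a i)^* *: 'X).

Lemma blaschkeE z : blaschke a z = blaschke_num.[z] / blaschke_den.[z].
Proof.
rewrite /blaschke big_split/= prodfV !horner_prod.
by congr (_ / _); apply: eq_bigr => i _; rewrite !hornerE.
Qed.

Lemma blaschke_den_neq0 z : abs z <= 1 -> blaschke_den.[z] != 0.
Proof.
move=> z1; rewrite horner_prod; apply/prodf_neq0 => i _.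
by rewrite !hornerE/= kernel_denom_neq0.
Qed.

Lemma blaschke_den_expi t : blaschke_den.[expi t] != 0.
Proof. by rewrite blaschke_den_neq0// abs_expi. Qed.

Lemma circle_factor w t : expi t - w = expi t * (1 - w^* * expi t)^*.
Proof.
rewrite conjB rmorph1 conjM conjCK mulrBr mulr1 mulrCA.
by rewrite expi_conj mulr1.
Qed.

Lemma blaschke_num_expi t :
  blaschke_num.[expi t] = (- expi t) ^+ m.+1 * (blaschke_den.[expi t])^*.
Proof.
rewrite !horner_prod conj_prod.
have -> : (- expi t) ^+ m.+1 = \prod_(i < m.+1) - expi t.
  by rewrite prodr_const card_ord.
rewrite -big_split.
apply: eq_bigr => i _; rewrite !hornerE/= mulNr -circle_factor opprB //.
Qed.

Lemma blaschke_root p : blaschke a (a p) = 0.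
Proof. by rewrite /blaschke (bigD1 p)//= subrr !mul0r. Qed.

Lemma blaschke_num_cofactor p z :
  blaschke_num.[z] = (-1) ^+ m.+1 * (z - a p) * (node_cofactor a p).[z].
Proof.
rewrite /blaschke_num !horner_prod.
under eq_bigr do rewrite hornerD hornerN hornerC hornerX -opprB.
rewrite prodrN card_ord -mulrA (bigD1 p)//=; congr (_ * (_ * _)).
by apply: eq_bigr => i _; rewrite hornerXsubC.
Qed.

Lemma conj_kernel_poly p z : z != a p ->
  conj_kernel (blaschke a) (a p) z =
  (-1) ^+ m.+1 * (node_cofactor a p).[z] / blaschke_den.[z].
Proof.
move=> zp; rewrite /conj_kernel blaschke_root subr0 blaschkeE.
rewrite (blaschke_num_cofactor p).
have d0 : z - a p != 0 by rewrite subr_eq0.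
by rewrite mulrAC; congr (_ / _); rewrite mulrAC mulfK.
Qed.

Lemma expi_neq_disk w t : in_disk w -> expi t != w.
Proof. by move=> wD; apply: contraTneq wD => <-; rewrite /in_disk abs_expi ltxx. Qed.

Lemma kernel_cofactor p t :
  cauchy_kernel (a p) (expi t) =
  (\prod_(i | i != p) (1 - (a i)^* * expi t)) / blaschke_den.[expi t].
Proof.
have E : blaschke_den.[expi t] = (1 - (a p)^* * expi t) *
    \prod_(i | i != p) (1 - (a i)^* * expi t).
  rewrite horner_prod (bigD1 p)//=; congr (_ * _); first by rewrite !hornerE.
  by apply: eq_bigr => i _; rewrite !hornerE.
rewrite /cauchy_kernel E invfM mulrCA mulfV ?mulr1//.
by apply/prodf_neq0 => i _; rewrite kernel_denom_neq0// abs_expi.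
Qed.

Lemma node_cofactor_expi p t : (node_cofactor a p).[expi t] =
  expi t ^+ m * (\prod_(i | i != p) (1 - (a i)^* * expi t))^*.
Proof.
rewrite horner_prod conj_prod.
have -> : expi t ^+ m = \prod_(i | i != p) expi t.
  by rewrite prodr_const cardC1 card_ord.
rewrite -big_split; apply: eq_bigr => i _.
by rewrite hornerXsubC circle_factor.
Qed.

(** On the circle [conj z = 1 / z], so conjugation reverses the coefficients. *)
Lemma reverse_conj P t : (size P <= m.+1)%N ->
  expi t ^+ m * (P.[expi t])^* =
  (\poly_(i < m.+1) (P`_(m - i))^*).[expi t].
Proof.
move=> sP; rewrite (horner_coef_wide _ sP) horner_poly conj_sum mulr_sumr.
rewrite (reindex_inj rev_ord_inj)/=; apply: eq_bigr => i _.
rewrite subSS conjM mulrCA conjX -[in _^* ^+ _]conjX.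
by rewrite conjX -conjX expi_expr_conj ?leq_subr// subKn// -ltnS.
Qed.

Hypothesis a_inj : injective a.

Lemma conj_kernel_expansion P : (size P <= m.+1)%N ->
  exists c : 'I_m.+1 -> R[i], forall t, P.[expi t] / blaschke_den.[expi t] =
    \sum_p c p * conj_kernel (blaschke a) (a p) (expi t).
Proof.
move=> sP; exists (fun p => (-1) ^+ m.+1 * (P.[a p] / (node_cofactor a p).[a p])).
move=> t; rewrite {1}(lagrange_interpolation a_inj sP) horner_sum mulr_suml.
apply: eq_bigr => p _; rewrite conj_kernel_poly; last exact: expi_neq_disk.
have ee : (-1) ^+ m.+1 * (-1) ^+ m.+1 = 1 :> R[i].
  by rewrite -exprMn mulrNN mulr1 expr1n.
rewrite hornerZ -[LHS]mul1r -[X in X * _ = _]ee.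
set x := P.[a p] / _; set d := (blaschke_den.[_])^-1; ring.
Qed.

(** Conjugation on the circle exchanges, up to a power of [z], the kernels and the
    conjugate kernels; so Lagrange interpolation at the zeros of [blaschke a] applies
    to the reversed conjugate of [P].  Interpolation of [P] itself at the reflected
    points [1 / (a p)^*] would fail when [a p] vanishes. *)
Lemma kernel_expansion P : (size P <= m.+1)%N ->
  exists c : 'I_m.+1 -> R[i], forall t, P.[expi t] / blaschke_den.[expi t] =
    \sum_p c p * cauchy_kernel (a p) (expi t).
Proof.
move=> sP; set Q := \poly_(i < m.+1) (P`_(m - i))^*.
have sQ : (size Q <= m.+1)%N by exact: size_poly.
exists (fun p => (Q.[a p] / (node_cofactor a p).[a p])^*) => t.
under eq_bigr do rewrite kernel_cofactor mulrA.
rewrite -mulr_suml; congr (_ / _).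
apply: (can_inj (@conjCK R[i])); apply: (mulfI (expf_neq0 m (expi_neq0 t))).
rewrite reverse_conj// -/Q {1}(lagrange_interpolation a_inj sQ) horner_sum.
rewrite conj_sum mulr_sumr; apply: eq_bigr => p _.
by rewrite hornerZ node_cofactor_expi conjM conjCK mulrCA.
Qed.

End BlaschkeAlgebra.

(** * Evaluation by kernels and the model space *)

Section ModelSpace.
Local Set Implicit Arguments.
Local Unset Strict Implicit.
Local Open Scope classical_set_scope.
Local Open Scope complex_scope.
Local Open Scope ring_scope.

Context {R : realType}.
Implicit Types (f g h : R[i] -> R[i]) (z w c : R[i]) (t : R) (P Q : {poly R[i]}).

Local Notation mu := (@lebesgue_measure R).
Local Arguments inner : simpl never.
Local Arguments circle_int : simpl never.

Lemma circle_int_kernel w : in_disk w -> circle_int (cauchy_kernel w) = 1.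
Proof.
move=> wD; have Hk := H2_kernel wD.
have -> : circle_int (cauchy_kernel w) =
    circle_int (fun z => 1 + w^* * (z * cauchy_kernel w z)).
  apply: circle_int_ext => t; rewrite /cauchy_kernel.
  have d0 : 1 - w^* * expi t != 0 by rewrite kernel_denom_neq0// abs_expi.
  by field.
have L1 : L2 (fun=> 1 : R[i]) by exact/L2_bounded/circle_bounded_cst.
have Lzk : L2 (fun z => z * cauchy_kernel w z).
  by apply: L2_boundedM; [exact: circle_bounded_id|exact: H2_L2].
rewrite circle_intD; last 2 first.
- exact: circle_integrable_L2.
- by apply: circle_integrable_L2; exact: L2Z.
rewrite circle_intZ; last exact: circle_integrable_L2.
rewrite circle_int1 (@circle_int_ext _ _ (fun z => z ^+ 1 * cauchy_kernel w z))//.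
by rewrite (H2_circle_int_expr 0 Hk) mulr0 addr0.
Qed.

(** Evaluation at [w]: the part of [G] divisible by [z - w] pairs to zero with
    the kernel, because [conj (cauchy_kernel w) = z / (z - w)] on the circle. *)
Lemma inner_kernel (G H : R[i] -> R[i]) w c : in_disk w -> H2 H ->
  (forall t, G (expi t) = c + (expi t - w) * H (expi t)) ->
  inner G (cauchy_kernel w) = c.
Proof.
move=> wD HH GE; have Lk := H2_L2 (H2_kernel wD).
have L1 : L2 (fun=> 1 : R[i]) by exact/L2_bounded/circle_bounded_cst.
have H1 : H2 (fun=> 1 : R[i]) by apply: H2_ext (H2_expr 0) => t; rewrite expr0.
have -> : inner G (cauchy_kernel w) =
    circle_int (fun z => c * (cauchy_kernel w z)^* + z * 1 * H z).
  apply: circle_int_ext => t; rewrite GE kernel_conj//.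
  have d0 : expi t - w != 0 by rewrite subr_eq0 expi_neq_disk.
  by field.
have LzH : L2 (fun z => z * 1 * H z).
  apply: L2_boundedM; last exact: H2_L2.
  by apply: circle_boundedM; [exact: circle_bounded_id|exact: circle_bounded_cst].
have Lck := L2_conj Lk.
rewrite circle_intD; last 2 first.
- by apply: circle_integrable_L2; exact: L2Z.
- exact: circle_integrable_L2.
rewrite (H2_circle_int_mul H1 HH) addr0 circle_intZ; last exact: circle_integrable_L2.
rewrite circle_int_conj; last exact: circle_integrable_L2.
by rewrite circle_int_kernel// rmorph1 mulr1.
Qed.

Lemma inner_horner_kernel Q w : in_disk w ->
  inner (horner Q) (cauchy_kernel w) = Q.[w].
Proof.
move=> wD; have /factor_theorem[Q1 Q1E] : root (Q - Q.[w]%:P) w.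
  by rewrite rootE !hornerE subrr.
apply: (inner_kernel (H := horner Q1)) => //; first exact: H2_horner.
move=> t; have /(congr1 (fun p => p.[expi t])) := Q1E.
by rewrite !hornerE => /eqP; rewrite subr_eq addrC => /eqP ->; rewrite mulrC.
Qed.

Context {m : nat} (a : 'I_m.+1 -> R[i]).
Hypothesis a_disk : forall i, in_disk (a i).
Hypothesis a_inj : injective a.

Local Notation alpha := (blaschke a).
Local Notation q := (blaschke_den a).

Lemma H2_fraction P : (size P <= m.+1)%N -> H2 (fun z => P.[z] / q.[z]).
Proof.
move=> /(kernel_expansion a_disk a_inj)[c E].
apply: H2_ext (H2_sum (index_enum _) (fun p => H2Z (c p) (H2_kernel (a_disk p)))).
by move=> t; rewrite E.
Qed.

Lemma circle_bounded_fraction P : (size P <= m.+1)%N ->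
  circle_bounded (fun z => P.[z] / q.[z]).
Proof.
move=> /(kernel_expansion a_disk a_inj)[c E].
apply: circle_bounded_ext (circle_bounded_sum (index_enum _) (fun p =>
  circle_boundedM (circle_bounded_cst (c p)) (circle_bounded_kernel (a_disk p)))).
by move=> t; rewrite E.
Qed.

Definition conj_kernel_num p : {poly R[i]} := (-1) ^+ m.+1 *: node_cofactor a p.

Lemma size_conj_kernel_num p : (size (conj_kernel_num p) <= m.+1)%N.
Proof. by rewrite (leq_trans (size_scale_leq _ _))// size_node_cofactor. Qed.

Lemma conj_kernel_fraction p z : z != a p ->
  conj_kernel alpha (a p) z = (conj_kernel_num p).[z] / q.[z].
Proof. by move=> zp; rewrite conj_kernel_poly// hornerZ. Qed.

Lemma conj_kernel_expi p t : conj_kernel alpha (a p) (expi t) =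
  (conj_kernel_num p).[expi t] / q.[expi t].
Proof. by rewrite conj_kernel_fraction// expi_neq_disk. Qed.

Lemma H2_conj_kernel p : H2 (conj_kernel alpha (a p)).
Proof.
apply: H2_ext (H2_fraction (size_conj_kernel_num p)) => t.
by rewrite conj_kernel_expi.
Qed.

Lemma circle_bounded_conj_kernel p : circle_bounded (conj_kernel alpha (a p)).
Proof.
apply: circle_bounded_ext (circle_bounded_fraction (size_conj_kernel_num p)) => t.
by rewrite conj_kernel_expi.
Qed.

Lemma conj_kernelM p t :
  conj_kernel alpha (a p) (expi t) * (expi t - a p) = alpha (expi t).
Proof.
rewrite /conj_kernel blaschke_root subr0 divfK// subr_eq0.
exact: expi_neq_disk.
Qed.

Lemma circle_bounded_blaschke : circle_bounded alpha.
Proof.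
apply: circle_bounded_ext (circle_boundedM (circle_bounded_conj_kernel ord0)
  (circle_boundedD (circle_bounded_id (R:=R)) (circle_bounded_cst (- a ord0)))) => t.
by rewrite conj_kernelM.
Qed.

Lemma blaschke_conj t : alpha (expi t) * (alpha (expi t))^* = 1.
Proof.
rewrite mul_conj blaschkeE absM absV (blaschke_num_expi a) absM absX absN.
rewrite abs_expi expr1n mul1r abs_conj mulfV ?expr1n//.
by rewrite abs_eq0 blaschke_den_expi.
Qed.

Lemma model_space_H2 f : model_space alpha f -> H2 f.
Proof. by case. Qed.

Lemma model_space_L2 f : model_space alpha f -> L2 f.
Proof. by move=> /model_space_H2 /H2_L2. Qed.

Lemma L2_blaschkeM h : H2 h -> L2 (fun z => alpha z * h z).
Proof. by move=> /H2_L2; exact: L2_boundedM circle_bounded_blaschke. Qed.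

Lemma model_space_ext f g : (forall t, f (expi t) = g (expi t)) ->
  model_space alpha f -> model_space alpha g.
Proof.
move=> fg [Hf f0]; split; first exact: H2_ext fg Hf.
by move=> h Hh; rewrite -(f0 h Hh); apply: inner_ext => // t; rewrite fg.
Qed.

Lemma model_spaceD f g : model_space alpha f -> model_space alpha g ->
  model_space alpha (fun z => f z + g z).
Proof.
move=> [Hf f0] [Hg g0]; split; first exact: H2D.
move=> h Hh; rewrite (innerDl (H2_L2 Hf) (H2_L2 Hg) (L2_blaschkeM Hh)).
by rewrite f0// g0// addr0.
Qed.

Lemma model_spaceZ c f : model_space alpha f ->
  model_space alpha (fun z => c * f z).
Proof.
move=> [Hf f0]; split; first exact: H2Z.
move=> h Hh; rewrite (innerZl c (H2_L2 Hf) (L2_blaschkeM Hh)).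
by rewrite f0// mulr0.
Qed.

Lemma model_space0 : model_space alpha (fun=> 0).
Proof. by split; [exact: H2_0|move=> h _; exact: inner0l]. Qed.

Lemma model_space_sum (I : Type) (r : seq I) (F : I -> R[i] -> R[i]) :
  (forall i, model_space alpha (F i)) ->
  model_space alpha (fun z => \sum_(i <- r) F i z).
Proof.
move=> HF; elim: r => [|i r IH].
  by apply: model_space_ext model_space0 => t; rewrite big_nil.
by apply: model_space_ext (model_spaceD (HF i) IH) => t; rewrite big_cons.
Qed.

(** The conjugate of the kernel at [a p] is [z / (z - a p)] on the circle, and
    [alpha / (z - a p)] is the conjugate kernel, again in H^2; so the scalar
    product with [alpha * h] is the conjugate of the mean of [z] times a product of
    two functions of H^2. *)
Lemma model_space_kernel p : model_space alpha (cauchy_kernel (a p)).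
Proof.
have Hk := H2_kernel (a_disk p); split; [exact: Hk|move=> h Hh].
rewrite (inner_conj (L2_blaschkeM Hh) (H2_L2 Hk)).
rewrite -[RHS](rmorph0 Num.conj) -(H2_circle_int_mul (H2_conj_kernel p) Hh).
congr (_^*); apply: circle_int_ext => t.
rewrite kernel_conj// -(conj_kernelM p).
have d0 : expi t - a p != 0 by rewrite subr_eq0 expi_neq_disk.
by field.
Qed.

Lemma model_space_fraction P : (size P <= m.+1)%N ->
  model_space alpha (fun z => P.[z] / q.[z]).
Proof.
move=> /(kernel_expansion a_disk a_inj)[c E].
apply: model_space_ext (model_space_sum (index_enum _)
  (fun p => model_spaceZ (c p) (model_space_kernel p))).
by move=> t; rewrite E.
Qed.

Lemma model_space_conj_kernel p : model_space alpha (conj_kernel alpha (a p)).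
Proof.
apply: model_space_ext (model_space_fraction (size_conj_kernel_num p)) => t.
by rewrite conj_kernel_expi.
Qed.

Lemma size_blaschke_den : (size q <= m.+2)%N.
Proof.
rewrite /blaschke_den (leq_trans (size_prod_leq _ _))//= card_ord leq_subLR.
rewrite -[X in (_ <= X)%N]addnS (leq_trans (n := (\sum_(i < m.+1) 2).+1))//.
  by rewrite ltnS; apply: leq_sum => i _; rewrite (leq_trans (size_polyD _ _))//
    size_polyN geq_max size_poly1 (leq_trans (size_scale_leq _ _))// size_polyX.
by rewrite sum_nat_const card_ord muln2 -addnn !addnS.
Qed.

Lemma inner_fraction_kernel P w : (size P <= m.+1)%N -> in_disk w ->
  inner (fun z => P.[z] / q.[z]) (cauchy_kernel w) = P.[w] / q.[w].
Proof.
move=> sP wD; set c := _ / _.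
have qw : q.[w] != 0 by apply: (blaschke_den_neq0 a_disk); exact: ltW.
have : root (P - c *: q) w by rewrite rootE !hornerE /= /c divfK// subrr.
move=> /factor_theorem[P1 P1E].
have sP1 : (size P1 <= m.+1)%N.
  have [->|P10] := eqVneq P1 0; first by rewrite size_poly0.
  have -> : size P1 = (size (P1 * ('X - w%:P))).-1.
    by rewrite size_Mmonic ?monicXsubC// size_XsubC addn2.
  rewrite -P1E -ltnS prednK ?size_poly_gt0 ?P1E ?mulf_neq0 ?polyXsubC_eq0//.
  rewrite -P1E (leq_trans (size_polyD _ _))//.
  rewrite size_polyN geq_max (leq_trans sP)//=.
  by rewrite (leq_trans (size_scale_leq _ _))// size_blaschke_den.
apply: (inner_kernel (H := fun z => P1.[z] / q.[z])) => //; first exact: H2_fraction.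
move=> t; have /(congr1 (fun p => p.[expi t])) := P1E.
rewrite !hornerE /= => /eqP; rewrite subr_eq => /eqP ->.
have := blaschke_den_expi a_disk t; move: (q.[_]) => d d0.
by field.
Qed.

Lemma inner_conj_kernel_kernel p p' :
  inner (conj_kernel alpha (a p)) (cauchy_kernel (a p')) =
  (p == p')%:R * ((conj_kernel_num p).[a p] / q.[a p]).
Proof.
rewrite -(inner_ext (f := fun z => (conj_kernel_num p).[z] / q.[z])
  (g := cauchy_kernel (a p')))//; last by move=> t; rewrite conj_kernel_expi.
rewrite inner_fraction_kernel ?size_conj_kernel_num//.
have [<-|pp'] := eqVneq p p'; first by rewrite mul1r.
by rewrite hornerZ node_cofactor_eq0 1?eq_sym// mulr0 !mul0r.
Qed.

Lemma sqnorm_eq0 g : L2 g -> sqnorm g = 0 -> circle_eq g (fun=> 0).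
Proof.
move=> Lg g0.
have : (\int[mu]_(t in angles) `|(abs (g (expi t)) ^+ 2)%:E| = 0)%E.
  rewrite -[RHS](_ : (2 * pi * sqnorm g)%:E = 0); last by rewrite g0 mulr0.
  rewrite -integral_sqnorm//; apply: eq_integral => t _.
  by rewrite /= ger0_norm// sqr_ge0.
have mg : measurable_fun (angles : set (measurableTypeR R))
    (fun t => (abs (g (expi t)) ^+ 2)%:E).
  by apply/measurable_EFinP; exact: measurable_abs_sqr (L2_measurable Lg).
move=> /(ae_eq_integral_abs mu (@measurable_angles R) mg).1 H.
apply: negligibleS H => t /= nH H; apply: nH => Dt.
have [/eqP] := H Dt; rewrite sqrf_eq0 abs_eq0 => /eqP; exact.
Qed.

(** On the circle [blaschke_num = (- z)^(m+1) * conj blaschke_den], so a Fourier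
    coefficient of [f * blaschke_den] of index beyond [m] is, up to sign, the scalar
    product of [f] with [alpha * (blaschke_den * z^j)]. *)
Lemma model_space_degree f j : model_space alpha f ->
  inner (fun z => q.[z] * f z) (fun z => z ^+ (m.+1 + j)) = 0.
Proof.
move=> [Hf f0]; have Lf := H2_L2 Hf.
have LX k : L2 (fun z : R[i] => z ^+ k) by exact: L2_expr.
have Lqf : L2 (fun z => q.[z] * f z).
  by apply: L2_boundedM => //; exact: circle_bounded_horner.
have s0 : (-1) ^+ m.+1 != 0 :> R[i] by rewrite signr_eq0.
apply: (mulfI s0); rewrite mulr0 -(f0 _ (H2_horner (q * 'X^j))).
rewrite -innerZl//; apply: circle_int_ext => t.
have -> : alpha (expi t) * (q * 'X^j).[expi t] =
    (- expi t) ^+ m.+1 * (q.[expi t])^* * expi t ^+ j.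
  rewrite blaschkeE hornerM hornerXn mulrA (divfK (blaschke_den_expi a_disk t)).
  by rewrite (blaschke_num_expi a).
rewrite [in RHS]exprNn !conjM conjCK !conjX rmorphN1 exprD.
by ring.
Qed.

(** The Fourier series of [f * blaschke_den] stops at degree [m].  Subtracting its
    polynomial part [P] leaves [g], orthogonal to all [z^k]; by density of the
    polynomials [g] is orthogonal to [f * blaschke_den] as well as to [P], hence to
    itself. *)
Lemma model_spaceP f : model_space alpha f ->
  exists2 P : {poly R[i]}, (size P <= m.+1)%N & circle_eq f (fun z => P.[z] / q.[z]).
Proof.
move=> Kf; have Hf := model_space_H2 Kf; have Lf := H2_L2 Hf.
have LX k : L2 (fun z : R[i] => z ^+ k) by exact: L2_expr.
have Lqf : L2 (fun z => q.[z] * f z).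
  by apply: L2_boundedM => //; exact: circle_bounded_horner.
pose gam k := inner (fun z => q.[z] * f z) (fun z => z ^+ k).
pose P := \poly_(k < m.+1) gam k.
have LP (Q : {poly R[i]}) : L2 (horner Q) by exact/L2_bounded/circle_bounded_horner.
pose g z := q.[z] * f z - P.[z].
have Lg : L2 g by exact: L2B.
have inner_horner (Q : {poly R[i]}) (u : R[i] -> R[i]) : L2 u ->
    inner (horner Q) u = \sum_(i < size Q) Q`_i * inner (fun z => z ^+ i) u.
  move=> Lu; rewrite -(inner_ext (f := fun z => \sum_(i < size Q) Q`_i * z ^+ i)
    (g := u))//; last by move=> t; rewrite horner_coef.
  rewrite inner_suml//; last by move=> i; exact: L2Z.
  by apply: eq_bigr => i _; rewrite innerZl.
have Xg k : inner (fun z => z ^+ k) g = 0.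
  rewrite inner_conj// innerBl//.
  have -> : inner (horner P) (fun z => z ^+ k) = P`_k.
    rewrite inner_horner//; under eq_bigr do rewrite inner_expr.
    have [kP|kP] := ltnP k (size P).
      rewrite (bigD1 (Ordinal kP))//= eqxx mulr1 big1 ?addr0// => i ik.
      have -> : (i == k :> nat) = false by apply: contraNF ik => /eqP ik; apply/eqP/val_inj.
      by rewrite mulr0.
    rewrite nth_default// big1// => i _.
    by rewrite (ltn_eqF (leq_trans (ltn_ord i) kP)) mulr0.
  rewrite coef_poly; case: ltnP => km; first by rewrite subrr rmorph0.
  by rewrite -(subnKC km) model_space_degree// subr0 rmorph0.
have hornerg (Q : {poly R[i]}) : inner (horner Q) g = 0.
  by rewrite inner_horner// big1// => i _; rewrite Xg mulr0.
have qfg : inner (fun z => q.[z] * f z) g = 0.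
  have Lqg : L2 (fun z => (q.[z])^* * g z).
    by apply: L2_boundedM => //; apply: circle_bounded_conj; exact: circle_bounded_horner.
  rewrite -(H2_orthogonal Hf Lqg).
    by apply: circle_int_ext => t; rewrite conjM conjCK mulrCA mulrA.
  move=> j; rewrite -(hornerg (q * 'X^j)); apply: circle_int_ext => t.
  by rewrite conjM conjCK hornerM hornerXn mulrCA mulrA.
have g0 : sqnorm g = 0.
  apply: (fmorph_inj (real_complex R)); rewrite /= -inner_sqnorm innerBl//.
  by rewrite qfg hornerg subrr.
exists P; first exact: size_poly.
apply: negligibleS (sqnorm_eq0 Lg g0) => t /= nH H; apply: nH => Dt.
have /eqP := H Dt; rewrite subr_eq0 => /eqP <-.
by rewrite mulrAC mulfV ?mul1r// blaschke_den_expi.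
Qed.

End ModelSpace.

(** * Matrix entries of truncated Toeplitz operators *)

Section TruncatedToeplitz.
Local Set Implicit Arguments.
Local Unset Strict Implicit.
Local Open Scope classical_set_scope.
Local Open Scope complex_scope.
Local Open Scope ring_scope.

Context {R : realType}.
Implicit Types (f g h phi : R[i] -> R[i]) (z w c : R[i]) (P Q : {poly R[i]}).

Local Notation mu := (@lebesgue_measure R).
Local Arguments inner : simpl never.
Local Arguments circle_int : simpl never.

Lemma cvg_horner (T : Type) (G : set_system T) {FG : Filter G} P
    (u : T -> R[i]^o) (l : R[i]^o) :
  u x @[x --> G] --> l -> (P.[u x] : R[i]^o) @[x --> G] --> (P.[l] : R[i]^o).
Proof.
move=> ul; have := cvg_sum_expr (c := fun k => P`_k) (N := size P) ul.
rewrite horner_coef big_mkord => H.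
rewrite (_ : (fun x => P.[u x]) = (fun x => \sum_(0 <= k < size P) P`_k * u x ^+ k)).
  exact: H.
by apply/funext => x; rewrite horner_coef big_mkord.
Qed.

Lemma inner_circle_eql f f' g : L2 f -> L2 f' -> L2 g -> circle_eq f f' ->
  inner f g = inner f' g.
Proof.
move=> Lf Lf' Lg ff'; apply: circle_eq_integral.
- exact: circle_measurableM (L2_measurable Lf) (L2_measurable (L2_conj Lg)).
- exact: circle_measurableM (L2_measurable Lf') (L2_measurable (L2_conj Lg)).
- apply: negligibleS ff' => t /= nH H; apply: nH => Dt.
  by have /= -> := H Dt.
Qed.

Lemma inner_circle_eqr f g g' : L2 f -> L2 g -> L2 g' -> circle_eq g g' ->
  inner f g = inner f g'.
Proof.
by move=> Lf Lg Lg' gg'; rewrite inner_conj// [RHS]inner_conj// (inner_circle_eql Lg Lg').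
Qed.

Lemma sqnorm_boundedM f phi (M : R) : 0 <= M -> circle_bounded phi ->
  (forall t, abs (phi (expi t)) <= M) -> L2 f ->
  sqnorm (fun z => phi z * f z) <= M ^+ 2 * sqnorm f.
Proof.
move=> M0 bphi phiM Lf; rewrite /sqnorm mulrCA ler_pM2l ?invr_gt0 ?twopi_gt0//.
rewrite -RintegralZl; [|exact: measurable_angles|exact: L2_integrable_sqr].
apply: le_Rintegral => [|||t _].
- exact: measurable_angles.
- exact: L2_integrable_sqr (L2_boundedM bphi Lf).
- have := integrableZl (@measurable_angles R) (M ^+ 2) (L2_integrable_sqr Lf).
  by apply: eq_integrable; [exact: measurable_angles|move=> t _ /=; rewrite EFinM].
rewrite absM exprMn ler_wpM2r ?sqr_ge0//.
by rewrite ler_pXn2r// nnegrE abs_ge0.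
Qed.

Context {m n : nat} (a : 'I_m.+1 -> R[i]) (b : 'I_n.+1 -> R[i]).
Hypotheses (a_disk : forall i, in_disk (a i)) (b_disk : forall j, in_disk (b j)).
Hypotheses (a_inj : injective a) (b_inj : injective b).

Local Notation alpha := (blaschke a).
Local Notation beta := (blaschke b).
Local Notation beta' s := (cderiv (blaschke b) (b s)).

(** As [beta] vanishes at [b s], its difference quotient there is the conjugate
    kernel, a fraction continuous at [b s]. *)
Lemma cderiv_blaschke s :
  beta' s = (conj_kernel_num b s).[b s] / (blaschke_den b).[b s].
Proof.
have d0 : (blaschke_den b).[b s] != 0 by apply: (blaschke_den_neq0 b_disk); exact: ltW (b_disk s).
have hb : (h + b s : R[i]^o) @[h --> (0 : R[i]^o)^'] --> (b s : R[i]^o).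
  rewrite -[X in _ --> X]add0r; apply: cvgD; last exact: cvg_cst.
  by move=> U; exact: cvg_within.
have H1 : ((conj_kernel_num b s).[h + b s] : R[i]^o) @[h --> (0 : R[i]^o)^'] -->
    ((conj_kernel_num b s).[b s] : R[i]^o) by apply: cvg_horner hb.
have H2 : ((blaschke_den b).[h + b s] : R[i]^o) @[h --> (0 : R[i]^o)^'] -->
    ((blaschke_den b).[b s] : R[i]^o) by apply: cvg_horner hb.
have H : ((conj_kernel_num b s).[h + b s] / (blaschke_den b).[h + b s] : R[i]^o)
    @[h --> (0 : R[i]^o)^'] -->
    ((conj_kernel_num b s).[b s] / (blaschke_den b).[b s] : R[i]^o).
  exact: (cvgM H1 (cvgV d0 H2)).
rewrite /cderiv /derive1; apply: (@cvg_lim R[i]^o); first exact: norm_hausdorff.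
apply: (cvg_trans _ H); apply: near_eq_cvg; near=> h.
have h0 : h != 0 by near: h; exact: nbhs_dnbhs_neq.
rewrite -conj_kernel_fraction; last by rewrite -subr_eq0 addrK.
by rewrite /conj_kernel addrK mulrC.
Unshelve. all: by end_near. Qed.

Lemma cderiv_blaschke_neq0 s : beta' s != 0.
Proof.
rewrite cderiv_blaschke mulf_neq0 ?invr_eq0//; last first.
  by apply: (blaschke_den_neq0 b_disk); exact: ltW (b_disk s).
by rewrite hornerZ mulf_neq0 ?signr_eq0 ?node_cofactor_neq0.
Qed.

Section Symbol.
Variables (A : (R[i] -> R[i]) -> (R[i] -> R[i])) (t : 'M[R[i]]_(n.+1, m.+1)).
Hypothesis A_lin : linear_map (model_space alpha) (model_space beta) A.
Hypothesis A_t : matrix_rep a b A t.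

Let Ltk p : L2 (conj_kernel alpha (a p)).
Proof. by apply: H2_L2; exact: H2_conj_kernel. Qed.

Let Lk s : L2 (cauchy_kernel (b s)).
Proof. by apply: H2_L2; exact: H2_kernel. Qed.

Let LA f : model_space alpha f -> L2 (A f).
Proof. by have [H _ _] := A_lin => /H/model_space_L2. Qed.

(** Up to the factors [beta' s], the kernels at the zeros of [beta] are
    biorthogonal to the conjugate kernels, so they extract the matrix entries. *)
Lemma inner_matrix_rep p s :
  inner (A (conj_kernel alpha (a p))) (cauchy_kernel (b s)) = beta' s * t s p.
Proof.
have LT : L2 (fun z => \sum_(s' < n.+1) t s' p * conj_kernel beta (b s') z).
  by apply: L2_sum => s'; apply: L2Z; apply: H2_L2; exact: H2_conj_kernel.
have LT' s' : L2 (fun z => t s' p * conj_kernel beta (b s') z).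
  by apply: L2Z; apply: H2_L2; exact: H2_conj_kernel.
rewrite (inner_circle_eql _ LT (Lk s) (A_t p)); last first.
  by apply: LA; exact: model_space_conj_kernel.
rewrite inner_suml// (bigD1 s)//= big1 => [|s' ss'].
  rewrite innerZl//; last by apply: H2_L2; exact: H2_conj_kernel.
  by rewrite inner_conj_kernel_kernel// eqxx mul1r addr0 -cderiv_blaschke mulrC.
rewrite innerZl//; last by apply: H2_L2; exact: H2_conj_kernel.
by rewrite inner_conj_kernel_kernel// (negPf ss') mul0r mulr0.
Qed.

Lemma inner_linear_map_sum (I : Type) (r : seq I) (c : I -> R[i])
    (F : I -> R[i] -> R[i]) f g :
  (forall i, model_space alpha (F i)) -> L2 g -> model_space alpha f ->
  circle_eq f (fun z => \sum_(i <- r) c i * F i z) ->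
  inner (A f) g = \sum_(i <- r) c i * inner (A (F i)) g.
Proof.
move=> KF Lg; have [AK Aeq Alin] := A_lin.
have KS s : model_space alpha (fun z => \sum_(i <- s) c i * F i z).
  exact: (model_space_sum a_disk a_inj s (fun i => model_spaceZ a_disk a_inj (c i) (KF i))).
have eqA f1 f2 : model_space alpha f1 -> model_space alpha f2 ->
    circle_eq f1 f2 -> inner (A f1) g = inner (A f2) g.
  by move=> K1 K2 e; exact: (inner_circle_eql (LA K1) (LA K2) Lg (Aeq _ _ K1 K2 e)).
have refl f1 f2 : (forall x, f1 (expi x) = f2 (expi x)) -> circle_eq f1 f2.
  by move=> E; apply: aeW => x _ /=; rewrite E.
have linA k f1 f2 : model_space alpha f1 -> model_space alpha f2 ->
    inner (A (fun z => k * f1 z + f2 z)) g = k * inner (A f1) g + inner (A f2) g.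
  move=> K1 K2; have K12 := model_spaceD a_disk a_inj (model_spaceZ a_disk a_inj k K1) K2.
  have LkA := L2Z k (LA K1).
  rewrite (inner_circle_eql (LA K12) (L2D LkA (LA K2)) Lg (Alin k _ _ K1 K2)).
  by rewrite (innerDl LkA (LA K2) Lg) (innerZl k (LA K1) Lg).
have sumA s : inner (A (fun z => \sum_(i <- s) c i * F i z)) g =
    \sum_(i <- s) c i * inner (A (F i)) g.
  elim: s => [|i s IH].
    have K0 := KS [::].
    have K1 := model_spaceD a_disk a_inj (model_spaceZ a_disk a_inj (-1) K0) K0.
    rewrite big_nil (eqA _ _ K0 K1).
      by rewrite (linA _ _ _ K0 K0) mulN1r addNr.
    by apply: refl => x; rewrite !big_nil mulr0 addr0.
  rewrite big_cons -IH -(linA _ _ _ (KF i) (KS s)); apply: eqA; first exact: KS.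
    exact: (model_spaceD a_disk a_inj (model_spaceZ a_disk a_inj (c i) (KF i)) (KS s)).
  by apply: refl => x; rewrite big_cons.
by move=> Kf fS; rewrite (eqA _ _ Kf (KS r) fS) sumA.
Qed.

Lemma kernel_partial_fractions x p s :
  (a p - b s) * ((expi x - a p)^-1 * (cauchy_kernel (b s) (expi x))^*) =
  (cauchy_kernel (a p) (expi x))^* - (cauchy_kernel (b s) (expi x))^*.
Proof.
rewrite !kernel_conj//.
have d1 : expi x - a p != 0 by rewrite subr_eq0 expi_neq_disk.
have d2 : expi x - b s != 0 by rewrite subr_eq0 expi_neq_disk.
by field; rewrite d1 d2.
Qed.

Lemma conj_kernel_div p x :
  conj_kernel alpha (a p) (expi x) = alpha (expi x) / (expi x - a p).
Proof.
have d1 : expi x - a p != 0 by rewrite subr_eq0 expi_neq_disk.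
by rewrite -(conj_kernelM a_disk p) mulfK.
Qed.

(** On the circle the entry with index [s, p] pairs the symbol with
    [alpha * z / ((z - a p) * (z - b s))], and multiplication by [a p - b s] splits
    this fraction into a term in [p] and a term in [s]. *)
Lemma in_ATTO_rank2 : in_ATTO alpha beta A ->
  exists (u : 'I_m.+1 -> R[i]) (v : 'I_n.+1 -> R[i]),
    forall s p, beta' s * (a p - b s) * t s p = u p - v s.
Proof.
move=> [phi [Lphi Aphi _]].
have Lpa : L2 (fun z => alpha z * phi z).
  by apply: L2_boundedM => //; exact: circle_bounded_blaschke.
exists (fun p => inner (fun z => alpha z * phi z) (cauchy_kernel (a p))).
exists (fun s => inner (fun z => alpha z * phi z) (cauchy_kernel (b s))).
move=> s p; have Ktk := model_space_conj_kernel a_disk a_inj p.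
have [_ _ /(_ _ (model_space_kernel b_disk b_inj s))] := Aphi _ Ktk.
have Lpt : L2 (fun z => phi z * conj_kernel alpha (a p) z).
  apply: L2_ext (L2_boundedM (circle_bounded_conj_kernel a_disk a_inj p) Lphi) => x.
  by rewrite mulrC.
rewrite innerBl//; last exact: LA.
move/eqP; rewrite subr_eq0 inner_matrix_rep mulrAC => /eqP <-.
rewrite mulrC -innerZl// -[RHS](_ : circle_int (fun z => alpha z * phi z *
  (cauchy_kernel (a p) z)^* + -1 * (alpha z * phi z * (cauchy_kernel (b s) z)^*)) = _).
  apply: circle_int_ext => x; rewrite mulN1r -mulrBr -kernel_partial_fractions.
  by rewrite conj_kernel_div; ring.
have Lka : L2 (cauchy_kernel (a p)) by apply: H2_L2; exact: H2_kernel.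
have ia := circle_integrable_inner Lpa Lka.
have ib := circle_integrable_inner Lpa (Lk s).
rewrite circle_intD//; first by rewrite circle_intZ// mulN1r.
apply: circle_integrable_ext (circle_integrable_inner (L2Z (-1) Lpa) (Lk s)) => x.
by rewrite [RHS]mulrA.
Qed.

(** Since [alpha * conj alpha = 1] on the circle, the symbol [conj alpha * Q] sends
    the conjugate kernel at [a p] to [Q / (z - a p)], and pairing with the kernel at
    [b s] gives the divided difference of [Q] at the two points, which is the
    derivative when they coincide. *)
Lemma inner_symbol_entry Q p s :
  inner (fun z => (alpha z)^* * Q.[z] * conj_kernel alpha (a p) z)
    (cauchy_kernel (b s)) =
  if a p == b s then (Q^`()).[b s] else (Q.[a p] - Q.[b s]) / (a p - b s).
Proof.
have LQ : L2 (horner Q) by exact/L2_bounded/circle_bounded_horner.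
have Lka : L2 (cauchy_kernel (a p)) by apply: H2_L2; exact: H2_kernel.
rewrite (_ : inner _ _ = circle_int (fun z => Q.[z] * ((z - a p)^-1 *
    (cauchy_kernel (b s) z)^*))); last first.
  apply: circle_int_ext => x; rewrite conj_kernel_div.
  transitivity (Q.[expi x] * (alpha (expi x) * (alpha (expi x))^*) *
      ((expi x - a p)^-1 * (cauchy_kernel (b s) (expi x))^*)); first by ring.
  by rewrite (blaschke_conj a_disk) mulr1.
case: eqVneq => [ab|ab].
  have /factor_theorem[Q1 Q1E] : root (Q - Q.[b s]%:P) (b s).
    by rewrite rootE !hornerE subrr.
  have {Q1E}Q1E : Q = Q.[b s]%:P + Q1 * ('X - (b s)%:P).
    by rewrite -Q1E addrC subrK.
  have LQ1 : L2 (horner Q1) by exact/L2_bounded/circle_bounded_horner.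
  have Hk := H2_kernel (b_disk s).
  have Lzkk : L2 (fun z => (z * cauchy_kernel (b s) z * cauchy_kernel (b s) z)^*).
    apply: L2_conj; apply: L2_boundedM (Lk s); apply: circle_boundedM.
      exact: circle_bounded_id.
    exact: circle_bounded_kernel.
  (* With Q = Q(b s) + Q1 * (z - b s), the constant contributes the mean of
     z / (z - b s)^2, the conjugate of that of z times the square of the kernel. *)
  rewrite [in RHS]Q1E derivD derivC derivM derivXsubC mulr1 add0r.
  rewrite hornerD hornerM hornerXsubC subrr mulr0 add0r.
  rewrite -(inner_horner_kernel Q1 (b_disk s)).
  have H0 : circle_int (fun z =>
      (z * cauchy_kernel (b s) z * cauchy_kernel (b s) z)^*) = 0.
    rewrite circle_int_conj ?(H2_circle_int_mul Hk Hk) ?rmorph0//.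
    apply: circle_integrable_ext (circle_integrable_L2 (L2_conj Lzkk)) => x.
    by rewrite conjCK.
  rewrite -[RHS]add0r -[in RHS](mulr0 Q.[b s]) -[in RHS]H0.
  rewrite -circle_intZ; last exact: circle_integrable_L2.
  rewrite -circle_intD; last 2 first.
  - by apply: circle_integrable_L2; exact: L2Z.
  - exact: circle_integrable_inner.
  apply: circle_int_ext => x; rewrite {1}Q1E ab !conjM !kernel_conj//.
  rewrite hornerD hornerC hornerM hornerXsubC.
  have d2 : expi x - b s != 0 by rewrite subr_eq0 expi_neq_disk.
  have -> : (expi x)^* = (expi x)^-1.
    by apply: (mulfI (expi_neq0 x)); rewrite expi_conj mulfV ?expi_neq0.
  by field; rewrite d2 expi_neq0.
have dab : a p - b s != 0 by rewrite subr_eq0.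
apply: (canRL (mulfK dab)).
rewrite -(inner_horner_kernel Q (a_disk p)) -(inner_horner_kernel Q (b_disk s)).
have LI : circle_integrable
    (fun z => Q.[z] * ((z - a p)^-1 * (cauchy_kernel (b s) z)^*)).
  have Lb : circle_bounded (fun z => (z - a p)^-1).
    have Lzk := circle_bounded_conj (circle_boundedM
      (circle_bounded_id (R:=R)) (circle_bounded_kernel (a_disk p))).
    apply: circle_bounded_ext Lzk => x; rewrite conjM kernel_conj//.
    by rewrite mulrA [_^* * _]mulrC expi_conj mul1r.
  apply: circle_integrable_ext (circle_integrable_inner (L2_boundedM Lb LQ) (Lk s)) => x.
  by rewrite mulrCA mulrA.
rewrite mulrC -circle_intZ//.
have ia := circle_integrable_inner LQ Lka.
have ib := circle_integrable_inner (L2Z (-1) LQ) (Lk s).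
rewrite -[X in _ = _ + X]mulN1r -(innerZl _ LQ (Lk s)) -circle_intD//.
apply: circle_int_ext => x.
by rewrite mulrCA kernel_partial_fractions; ring.
Qed.

Lemma circle_bounded_symbol Q : circle_bounded (fun z => (alpha z)^* * Q.[z]).
Proof.
apply: circle_boundedM; last exact: circle_bounded_horner.
by apply: circle_bounded_conj; exact: circle_bounded_blaschke.
Qed.

(** An operator with bounded symbol [phi] satisfies [|A f| <= |phi f|], since
    [A f] is orthogonal to [phi f - A f]. *)
Lemma is_ATTO_bounded phi : circle_bounded phi -> is_ATTO alpha beta phi A ->
  bounded_map (model_space alpha) A.
Proof.
move=> bphi Aphi; have [_ [M phiM]] := bphi.
have M0 : 0 <= M by rewrite (le_trans _ (phiM 0))// abs_ge0.
exists M => f Kf; have [Lpf KA orth] := Aphi f Kf.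
have LAf := LA Kf; have Lf := model_space_L2 Kf.
have le1 : sqnorm (A f) <= sqnorm (fun z => phi z * f z).
  have := sqnorm_ge0 (fun z => phi z * f z - 1 * A f z).
  rewrite sqnorm_sub// abs1 expr1n mul1r rmorph1 mul1r.
  have := orth _ KA; rewrite innerBl// => /eqP; rewrite subr_eq0 => /eqP ->.
  by rewrite inner_sqnorm /=; lra.
have le2 := sqnorm_boundedM M0 bphi phiM Lf.
rewrite /L2norm !inner_sqnorm /= -{1}(ger0_norm M0) -sqrtr_sqr -sqrtrM ?sqr_ge0//.
by rewrite ler_wsqrtr// (le_trans le1).
Qed.

(** The symbol is sought as [conj alpha * Q] with [Q] a polynomial.  Its values on
    the zeros of [alpha] and [beta] must be [u] and [v]; at a common zero the
    equation for [u] and [v] says only that they agree, and the entry, which it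
    leaves free, prescribes the derivative of [Q]. *)
Lemma rank2_in_ATTO (u : 'I_m.+1 -> R[i]) (v : 'I_n.+1 -> R[i]) :
  (forall s p, beta' s * (a p - b s) * t s p = u p - v s) ->
  in_ATTO alpha beta A.
Proof.
move=> uv.
pose V x := if [pick p | a p == x] is Some p then u p
            else if [pick s | b s == x] is Some s then v s else 0.
pose W x := if [pick sp | (b sp.1 == x) && (a sp.2 == x)] is Some sp
            then beta' sp.1 * t sp.1 sp.2 else 0.
have Va p : V (a p) = u p.
  rewrite /V; case: pickP => [p' /eqP /a_inj -> //|/(_ p)]; by rewrite eqxx.
have Vb s : V (b s) = v s.
  rewrite /V; case: pickP => [p /eqP ap|_].
    by apply/eqP; rewrite -subr_eq0 -uv ap subrr mulr0 mul0r.
  case: pickP => [s' /eqP /b_inj -> //|/(_ s)]; by rewrite eqxx.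
have Wab s p : a p = b s -> W (b s) = beta' s * t s p.
  move=> ab; rewrite /W; case: pickP => [[s' p'] /= /andP[/eqP /b_inj -> /eqP]|].
    by rewrite -ab => /a_inj ->.
  by move=> /(_ (s, p)); rewrite /= ab !eqxx.
have [Q HQ] := hermite_interpolation V W
  (undup_uniq ([seq a p | p <- enum 'I_m.+1] ++ [seq b s | s <- enum 'I_n.+1])).
have Qa p : Q.[a p] = u p.
  rewrite -Va; apply: (HQ _ _).1.
  by rewrite mem_undup mem_cat map_f ?mem_enum.
have Qb s : Q.[b s] = v s /\ (Q^`()).[b s] = W (b s).
  rewrite -Vb; apply: HQ.
  by rewrite mem_undup mem_cat orbC map_f ?mem_enum.
pose phi z := (alpha z)^* * Q.[z].
have bphi : circle_bounded phi by exact: circle_bounded_symbol.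
have entry p s : inner (fun z => phi z * conj_kernel alpha (a p) z)
    (cauchy_kernel (b s)) = beta' s * t s p.
  rewrite inner_symbol_entry Qa (Qb s).1 (Qb s).2.
  case: eqVneq => [/Wab //|ab].
  have dab : a p - b s != 0 by rewrite subr_eq0.
  by apply: (canLR (mulfK dab)); rewrite -uv mulrAC.
suff Aphi : is_ATTO alpha beta phi A.
  by exists phi; split; [exact: L2_bounded|exact: Aphi|exact: is_ATTO_bounded Aphi].
(* Both model spaces are spanned by kernels, so it suffices to compare the
   operators on the conjugate kernels, tested against the kernels. *)
move=> f Kf; have Lf := model_space_L2 Kf; have LAf := LA Kf.
have Lpf : L2 (fun z => phi z * f z) by exact: L2_boundedM.
have [KA _ _] := A_lin.
split; [exact: Lpf|exact: KA|move=> h Kh].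
have [P sP fP] := model_spaceP a_disk Kf.
have [c Ec] := conj_kernel_expansion a_disk a_inj sP.
have [P' sP' hP'] := model_spaceP b_disk Kh.
have [d Ed] := kernel_expansion b_disk b_inj sP'.
have fc : circle_eq f (fun z => \sum_p c p * conj_kernel alpha (a p) z).
  by apply: negligibleS fP => x /= nH H; apply: nH => Dx; rewrite (H Dx) Ec.
have hd : circle_eq h (fun z => \sum_s d s * cauchy_kernel (b s) z).
  by apply: negligibleS hP' => x /= nH H; apply: nH => Dx; rewrite (H Dx) Ed.
have Lct p : L2 (fun z => c p * conj_kernel alpha (a p) z) by exact: L2Z.
have Ldk s : L2 (fun z => d s * cauchy_kernel (b s) z) by exact: L2Z.
have LD : L2 (fun z => phi z * f z - A f z) by exact: L2B.
rewrite (inner_circle_eqr LD (model_space_L2 Kh) (L2_sum _ Ldk) hd).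
rewrite inner_sumr// big1// => s _; rewrite innerZr// innerBl//.
rewrite (inner_linear_map_sum (fun p => model_space_conj_kernel a_disk a_inj p)
  (Lk s) Kf fc).
have Lphit p : L2 (fun z => phi z * conj_kernel alpha (a p) z) by exact: L2_boundedM.
rewrite (inner_circle_eql (f' := fun z => \sum_p
  c p * (phi z * conj_kernel alpha (a p) z)) Lpf)//; last 2 first.
- by apply: L2_sum => p; exact: L2Z.
- apply: negligibleS fc => x /= nH H; apply: nH => Dx; rewrite (H Dx) mulr_sumr.
  by apply: eq_bigr => p _; rewrite mulrCA.
rewrite inner_suml//; last by move=> p; exact: L2Z.
rewrite -sumrB big1 ?mulr0// => p _; rewrite innerZl// entry.
by rewrite inner_matrix_rep subrr.
Qed.

End Symbol.

End TruncatedToeplitz.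

(** * Expressing the entries by the first row and column *)

Section Rank2Indices.
Local Set Implicit Arguments.
Local Unset Strict Implicit.

(** The indices below [l] already give [l] common zeros, so by counting there are
    no others; injectivity then excludes coincidences of different indices. *)
Lemma common_zerosP (R : realType) m n l (a : 'I_m.+1 -> R[i]) (b : 'I_n.+1 -> R[i]) :
  injective a -> injective b -> common_zeros a b l ->
  [/\ (l <= m.+1)%N, (l <= n.+1)%N &
      forall (p : 'I_m.+1) (s : 'I_n.+1),
        (a p == b s) = (p == s :> nat) && (p < l)%N].
Proof.
move=> a_inj b_inj [cardC ab].
set C : pred 'I_m.+1 := [pred i | [exists j, a i == b j]] in cardC.
have lm : (l <= m.+1)%N by rewrite -cardC -[X in (_ <= X)%N]card_ord max_card.
have ln : (l <= n.+1)%N.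
  rewrite -cardC; pose g (i : 'I_m.+1) : 'I_n.+1 := odflt ord0 [pick j | a i == b j].
  have gE i : i \in C -> a i = b (g i).
    move=> /existsP[j ij]; rewrite /g; case: pickP => [j' /eqP //|/(_ j)].
    by rewrite ij.
  have g_inj : {in C &, injective g}.
    by move=> i i' /gE Ei /gE Ei' gg; apply: a_inj; rewrite Ei Ei' gg.
  by rewrite -(card_in_image g_inj) -[X in (_ <= X)%N]card_ord max_card.
split=> // p s.
have sub : [pred i : 'I_m.+1 | (i < l)%N] \subset C.
  apply/fintype.subsetP => i; rewrite !inE => il; apply/existsP.
  have iln := leq_trans il ln.
  by exists (Ordinal iln); apply/eqP/ab.
have cardL : #|[pred i : 'I_m.+1 | (i < l)%N]| = l.
  rewrite -sum1_card -[RHS]muln1 -[in RHS](card_ord l) -sum_nat_const.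
  by rewrite (big_ord_widen _ (fun=> 1%N) lm).
have CE : [pred i : 'I_m.+1 | (i < l)%N] =i C.
  by apply/subset_cardP => //; rewrite cardL cardC.
apply/eqP/andP => [aps|[/eqP ps pl]]; last exact: ab.
have pl : (p < l)%N.
  by have := CE p; rewrite !inE => ->; apply/existsP; exists s; apply/eqP.
split=> //; have pn := leq_trans pl ln.
have /b_inj <- // : b (Ordinal pn) = b s by rewrite -aps; apply/esym/ab.
Qed.

Context {K : fieldType} {m n l : nat}.
Context (a : 'I_m.+1 -> K) (b g : 'I_n.+1 -> K) (t : 'M[K]_(n.+1, m.+1)).
Hypothesis g0 : forall s, g s != 0.
Hypothesis lm : (l <= m.+1)%N.
Hypothesis ab : forall (p : 'I_m.+1) (s : 'I_n.+1),
  (a p == b s) = (p == s :> nat) && (p < l)%N.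

Let r s p := g s * (a p - b s) * t s p.

Lemma entry_formula s p x : a p != b s ->
  t s p = x / (g s * (a p - b s)) <-> r s p = x.
Proof.
move=> ps; have d0 : g s * (a p - b s) != 0 by rewrite mulf_neq0// subr_eq0.
rewrite /r; split=> [->|<-]; first by rewrite mulrC divfK.
by rewrite mulrAC mulfV// mul1r.
Qed.

(** A matrix of the form [u p - v s] is determined by its first row and column,
    from which [u] and [v] are read off. *)
Lemma rank2_no_common_zero : l = 0%N ->
  (exists u v, forall s p, r s p = u p - v s) <->
  forall s p, t s p = (g s * (a ord0 - b s) * t s ord0
                + g ord0 * (b ord0 - a ord0) * t ord0 ord0
                + g ord0 * (a p - b ord0) * t ord0 p) / (g s * (a p - b s)).
Proof.
move=> l0; have nab p s : a p != b s by rewrite ab l0 ltn0 andbF.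
have E s p : g s * (a ord0 - b s) * t s ord0
    + g ord0 * (b ord0 - a ord0) * t ord0 ord0
    + g ord0 * (a p - b ord0) * t ord0 p = r s ord0 - r ord0 ord0 + r ord0 p.
  by rewrite /r; ring.
split=> [[u [v uv]] s p|H].
  by apply/entry_formula => //; rewrite E !uv; ring.
exists (r ord0), (fun s => r ord0 ord0 - r s ord0) => s p.
by have /entry_formula -> // := H s p; rewrite E; ring.
Qed.

(** Here [a ord0 = b ord0], so [r] vanishes in its corner, and for [s < l] the value
    [v s = u s] is read off from the first row. *)
Lemma rank2_common_zeros : (0 < l)%N ->
  (exists u v, forall s p, r s p = u p - v s) <->
  (forall (s : 'I_n.+1) (p : 'I_m.+1), (s < l)%N -> s <> p :> nat ->
     t s p = (g ord0 * (a ord0 - b s) * t ord0 (inord s)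
              + g ord0 * (a p - b ord0) * t ord0 p) / (g s * (a p - b s))) /\
  (forall (s : 'I_n.+1) (p : 'I_m.+1), (l <= s)%N ->
     t s p = (g s * (a ord0 - b s) * t s ord0
              + g ord0 * (a p - b ord0) * t ord0 p) / (g s * (a p - b s))).
Proof.
move=> l0; have ab0 : a ord0 = b ord0 by apply/eqP; rewrite ab eqxx.
have r00 : r ord0 ord0 = 0 by rewrite /r ab0 subrr mulr0 mul0r.
have abs (s : 'I_n.+1) : (s < l)%N -> a (inord s) = b s.
  by move=> sl; apply/eqP; rewrite ab inordK ?eqxx// (leq_trans sl).
have E1 (s : 'I_n.+1) p : (s < l)%N -> g ord0 * (a ord0 - b s) * t ord0 (inord s)
    + g ord0 * (a p - b ord0) * t ord0 p = r ord0 p - r ord0 (inord s).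
  by move=> sl; rewrite /r ab0 -(abs s sl); ring.
have E2 s p : g s * (a ord0 - b s) * t s ord0
    + g ord0 * (a p - b ord0) * t ord0 p = r s ord0 + r ord0 p by [].
split=> [[u [v uv]]|[H1 H2]].
  have uv0 : u ord0 = v ord0 by apply/eqP; rewrite -subr_eq0 -uv r00.
  split=> s p sl.
    move=> sp; have nab : a p != b s.
      by rewrite ab negb_and; apply/orP; left; apply/eqP => /esym.
    apply/entry_formula => //; rewrite E1// !uv.
    have : r s (inord s) = 0 by rewrite /r abs// subrr mulr0 mul0r.
    by rewrite uv => /eqP; rewrite subr_eq0 => /eqP ->; ring.
  have nab : a p != b s.
    rewrite ab negb_and; apply/orP.
    have [ps|] := eqVneq (p : nat) s; last by left.
    by right; rewrite ps -leqNgt.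
  by apply/entry_formula => //; rewrite E2 !uv uv0; ring.
exists (r ord0), (fun s : 'I_n.+1 => if (s < l)%N then r ord0 (inord s) else - r s ord0).
move=> s p; case: ltnP => sl.
  have [sp|/eqP sp] := eqVneq (s : nat) p.
    have -> : inord s = p by apply/val_inj; rewrite /= inordK// sp.
    by rewrite subrr /r -(abs s sl) sp inord_val subrr mulr0 mul0r.
  have nab : a p != b s.
    by rewrite ab negb_and; apply/orP; left; apply/eqP => /esym.
  by have /entry_formula -> // := H1 s p sl sp; rewrite E1.
have nab : a p != b s.
  rewrite ab negb_and; apply/orP.
  have [ps|] := eqVneq (p : nat) s; last by left.
  by right; rewrite ps -leqNgt.
by have /entry_formula -> // := H2 s p sl; rewrite E2 opprK addrC.
Qed.

End Rank2Indices.

(* The numbers of zeros are m.+1 and n.+1, and indices start at 0. *)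
Theorem theorem3p3 (R : realType) (m n l : nat)
    (a : 'I_m.+1 -> R[i]) (b : 'I_n.+1 -> R[i])
    (a_disk : forall i, in_disk (a i)) (b_disk : forall j, in_disk (b j))
    (a_inj : injective a) (b_inj : injective b)
    (ab_common : common_zeros a b l)
    (A : (R[i] -> R[i]) -> (R[i] -> R[i]))
    (A_lin : linear_map (model_space (blaschke a)) (model_space (blaschke b)) A)
    (t : 'M[R[i]]_(n.+1, m.+1))
    (A_t : matrix_rep a b A t) :
  let beta' := cderiv (blaschke b) in
  (l = 0%N ->
    (in_ATTO (blaschke a) (blaschke b) A <->
     forall (s : 'I_n.+1) (p : 'I_m.+1),
       t s p = (beta' (b s) * (a ord0 - b s) * t s ord0
                + beta' (b ord0) * (b ord0 - a ord0) * t ord0 ord0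
                + beta' (b ord0) * (a p - b ord0) * t ord0 p)
               / (beta' (b s) * (a p - b s)))) /\
  ((0 < l)%N ->
    (in_ATTO (blaschke a) (blaschke b) A <->
     (* when s < l, inord s : 'I_m.+1 is the column index with value s *)
     (forall (s : 'I_n.+1) (p : 'I_m.+1), (s < l)%N -> s <> p :> nat ->
       t s p = (beta' (b ord0) * (a ord0 - b s) * t ord0 (inord s)
                + beta' (b ord0) * (a p - b ord0) * t ord0 p)
               / (beta' (b s) * (a p - b s))) /\
     (forall (s : 'I_n.+1) (p : 'I_m.+1), (l <= s)%N ->
       t s p = (beta' (b s) * (a ord0 - b s) * t s ord0
                + beta' (b ord0) * (a p - b ord0) * t ord0 p)
               / (beta' (b s) * (a p - b s))))).
Proof.
have [lm ln ab] := common_zerosP a_inj b_inj ab_common.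
have core : in_ATTO (blaschke a) (blaschke b) A <->
    exists u v, forall s p,
      cderiv (blaschke b) (b s) * (a p - b s) * t s p = u p - v s.
  split; first exact: in_ATTO_rank2.
  by move=> [u [v uv]]; exact: rank2_in_ATTO uv.
have g0 s := cderiv_blaschke_neq0 b_disk b_inj s.
move=> beta'; split=> l0.
  exact: (iff_trans core (rank2_no_common_zero t g0 ab l0)).
exact: (iff_trans core (rank2_common_zeros t g0 lm ab l0)).
Qed.
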